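(* Let $\sigma = (f, \varphi)$ be a smooth section of $J^1(\mathbb{R}^m \times \mathbb{R} \times \mathbb{R}^k , \mathbb{R}^n)$ defined near $A = [0,1]^m \times \{0\} \times \{0\}$ and let $\epsilon$ be a positive real number. 1. Let $\delta : \mathbb{R}^m \to \mathbb{R}$ and $h : \mathbb{R}^m \to \mathbb{R}^n$ be smooth maps. The function $(x, \delta(x), 0) \mapsto h(x)$, defined on $A_\delta$, can be extended to a function $f_1$ defined near $A_\delta$ such that $(\delta, f_1)$ is a solution of the holonomic $\epsilon$-approximation problem for $\sigma$ near $A$ if and only if $(\delta, h)$ is a solution of the relation $\mathcal{R}_{ha}(\sigma, \epsilon)$. 2. The relation $\mathcal{R}_{ha}(\sigma, \epsilon) \subset J^1(\mathbb{R}^m, \mathbb{R} \times \mathbb{R}^n)$ is open and ample.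
   Context: **Jet spaces.** For manifolds $M, N$, $J^1(M,N)$ is the space of triples $(p, q, \theta)$ with $p \in M$, $q \in N$ and $\theta : T_pM \to T_qN$ linear. A section $\sigma=(f,\varphi)$ of $J^1(M,N)$ over an open set $U \subset M$ is given by a smooth map $f : U \to N$ and linear maps $\varphi(p) : T_pM \to T_{f(p)}N$ depending smoothly on $p \in U$. The section associated to a smooth map $f_1$ is $j^1 f_1 = (f_1, df_1)$. ''Defined near $K$'' means defined on some open neighborhood of $K$; functions are smooth. **Norms.** $\mathbb{R}^m\times\mathbb{R}\times\mathbb{R}^k$ (coordinates $(x,y,z)$) carries the Euclidean norm, $\mathbb{R}^n$ carries the sup norm, and linear maps carry the corresponding operator norm. **Deformed cell.** For $\delta : \mathbb{R}^m \to \mathbb{R}$, $A_\delta = \{(x,y,z) \in \mathbb{R}^m\times\mathbb{R}\times\mathbb{R}^k \mid x \in [0,1]^m,\ y=\delta(x),\ z=0\}$. **Holonomic $\epsilon$-approximation problem.** Let $\sigma=(f,\varphi)$ be defined on an open neighborhood $U$ of $A$. A pair $(\delta, f_1)$, with $\delta:\mathbb{R}^m\to\mathbb{R}$ smooth and $f_1$ a smooth $\mathbb{R}^n$-valued map defined near $A_\delta$, is a solution of the holonomic $\epsilon$-approximation problem for $\sigma$ near $A$ if $\|\delta\|_0 < \epsilon$ (supremum of $|\delta|$ over $[0,1]^m$) and $\|j^1 f_1 - \sigma\|_0 < \epsilon$ near $A_\delta$. The latter means that there is a compact neighborhood of $A_\delta$, contained in $U$ and in the domain of $f_1$, on which the suprema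 of $\|f_1 - f\|$ and of the operator norm $\|df_1 - \varphi\|$ are both $<\epsilon$. **The relation $\mathcal{R}_{ha}$.** An element of $J^1(\mathbb{R}^m, \mathbb{R}\times\mathbb{R}^n)$ is written $(x,(y,w),(Y,W))$ with $x \in \mathbb{R}^m$, $(y,w)\in\mathbb{R}\times\mathbb{R}^n$, and $(Y,W)$ a linear map $\mathbb{R}^m \to \mathbb{R}\times\mathbb{R}^n$. Let $\Gamma_Y = \{(v, Y v) \mid v \in \mathbb{R}^m\} \subset \mathbb{R}^m\times\mathbb{R}$ be the graph of the linear form $Y$, and let $p_m : \mathbb{R}^m\times\mathbb{R}\times\mathbb{R}^k\to\mathbb{R}^m$ be the projection. Then $\mathcal{R}_{ha}(\sigma,\epsilon)$ is the set of all $(x,(y,w),(Y,W))\in J^1(\mathbb{R}^m,\mathbb{R}\times\mathbb{R}^n)$ such that $(x,y,0)$ is in the domain $U$ of $\sigma$ and $$|y|<\epsilon,\qquad \|w-f(x,y,0)\|<\epsilon,\qquad \left\|\big(W\circ p_m-\varphi(x,y,0)\big)_{|\Gamma_Y\times\{0\}}\right\|<\epsilon .$$ The pair $(\delta,h)$ is a solution of $\mathcal{R}_{ha}(\sigma,\epsilon)$ if $\big(x,(\delta(x),h(x)),(d\delta(x),dh(x))\big)\in\mathcal{R}_{ha}(\sigma,\epsilon)$ for all $x$ in some neighborhood of $[0,1]^m$. **Ampleness.** A subset $\Omega$ of a (finite-dimensional) real affine space is ample if the convex hull of each connected component of $\Omega$ is the whole space (in particular the empty set is ample). For manifolds $M,N$,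 points $p \in M$, $q\in N$, a hyperplane $\tau\subset T_pM$ and a linear map $L:\tau\to T_qN$, the principal affine subspace $P_{\tau,L}\subset J^1(M,N)$ is the set of $(p,q,\theta)$ with $\theta_{|\tau}=L$. A subset $\mathcal{R}\subset J^1(M,N)$ is ample if for every such $P_{\tau,L}$ the slice $\mathcal{R}\cap P_{\tau,L}$ is ample in $P_{\tau,L}$. *)

(* Defs.v *)
From HB Require Import structures.
From mathcomp Require Import all_boot all_order all_algebra.
From mathcomp Require Import all_classical all_reals all_analysis.
Set Implicit Arguments.
Unset Strict Implicit.
Unset Printing Implicit Defensive.
Import Order.TTheory GRing.Theory Num.Theory.
Import numFieldNormedType.Exports.
Local Open Scope classical_set_scope.
Local Open Scope ring_scope.

(* Conventions.  R^d is 'rV[R]_d; a linear map R^a -> R^b is a matrix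
   M : 'M[R]_(a, b) acting on row vectors by v |-> v *m M, which is the
   convention of the Jacobian 'J.  R^m x R x R^k is 'rV[R]_(m + 1 + k) and
   R x R^n is 'rV[R]_(1 + n), decomposed by blocks. *)

Fixpoint Ck_on (R : realType) (V W : normedModType R) (r : nat)
    (U : set V) (f : V -> W) : Prop :=
  match r with
  | 0%N => forall p, U p -> {for p, continuous f}
  | r'.+1 => (forall p, U p -> differentiable f p) /\
             (forall v : V, Ck_on r' U (fun p => 'D_v f p))
  end.

(* This is C^infinity smoothness when U is open and V finite-dimensional. *)
Definition smooth_on (R : realType) (V W : normedModType R)
    (U : set V) (f : V -> W) : Prop := forall r, Ck_on r U f.

(* Euclidean norm.  The library norm `|w| of a row vector is the sup norm; it is
   the norm used on targets R^n. *)

Definition enorm (R : realType) d (v : 'rV[R]_d) : R :=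
  Num.sqrt (\sum_(i < d) v 0 i ^+ 2).

(* Operator norm of the restriction to the linear subspace S of the linear map
   L; the set is nonempty (it contains `|L 0|) and bounded above. *)
Definition opnorm_on (R : realType) a b (S : set 'rV[R]_a)
    (L : 'rV[R]_a -> 'rV[R]_b) : R :=
  sup [set `|L v| | v in [set v | S v /\ enorm v <= 1]].

Definition opnorm (R : realType) a b (M : 'M[R]_(a, b)) : R :=
  opnorm_on setT (mulmx^~ M).

Definition sup_over (R : realType) (T : Type) (K : set T) (g : T -> R) : \bar R :=
  ereal_sup [set (g p)%:E | p in K].

(* J^1(R^a, R^b), with T_p R^a identified with R^a; the product structure makes
   it a normed vector space, of which principal subspaces are affine subspaces. *)

Notation jet R a b := ('rV[R]_a * 'rV[R]_b * 'M[R]_(a, b))%type.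

Definition j1 (R : realType) a b (f : 'rV[R]_a -> 'rV[R]_b) (p : 'rV[R]_a) :
  jet R a b := (p, f p, 'J f p).

(* sfun and slin are total functions; only their values on sdom matter. *)
Record jet_section (R : realType) (a b : nat) := JetSection {
  sdom : set 'rV[R]_a ;
  sfun : 'rV[R]_a -> 'rV[R]_b ;
  slin : 'rV[R]_a -> 'M[R]_(a, b) ;
  sdom_open : open sdom ;
  sfun_smooth : smooth_on sdom sfun ;
  slin_smooth : smooth_on sdom slin }.

Definition cube (R : realType) m : set 'rV[R]_m :=
  [set x | forall i, 0 <= x 0 i <= 1].
Arguments cube {R m}.

Definition pt (R : realType) m k (x : 'rV[R]_m) (y : R) (z : 'rV[R]_k) :
  'rV[R]_(m + 1 + k) := row_mx (row_mx x y%:M) z.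

Definition cell (R : realType) m k (delta : 'rV[R]_m -> R) :
  set 'rV[R]_(m + 1 + k) := [set pt x (delta x) 0 | x in cube].
Arguments cell {R m} k delta.

(* f1 is a map with domain V. *)
Definition holonomic_solution (R : realType) m n k
    (sigma : jet_section R (m + 1 + k) n) (eps : R)
    (delta : 'rV[R]_m -> R)
    (V : set 'rV[R]_(m + 1 + k)) (f1 : 'rV[R]_(m + 1 + k) -> 'rV[R]_n) : Prop :=
  [/\ smooth_on setT delta,
      [/\ open V, cell k delta `<=` V & smooth_on V f1],
      (sup_over cube (fun x => `|delta x|%R) < eps%:E)%E &
      exists K : set 'rV[R]_(m + 1 + k),
        [/\ compact K, set_nbhs (cell k delta) K,
            K `<=` sdom sigma `&` V,
            (sup_over K (fun p => `|f1 p - sfun sigma p|%R) < eps%:E)%E &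
            (sup_over K (fun p => opnorm ('J f1 p - slin sigma p)%R)
               < eps%:E)%E]].

Definition proj_m (R : realType) m k (u : 'rV[R]_(m + 1 + k)) : 'rV[R]_m :=
  lsubmx (lsubmx u).

(* Gamma_Y x {0} *)
Definition graph0 (R : realType) m k (Y : 'M[R]_(m, 1)) :
  set 'rV[R]_(m + 1 + k) := [set pt v ((v *m Y) 0 0) 0 | v in setT].
Arguments graph0 {R m} k Y.

Definition Rha (R : realType) m n k (sigma : jet_section R (m + 1 + k) n)
    (eps : R) : set (jet R m (1 + n)) :=
  [set j | let x := j.1.1 in
           let y := (lsubmx j.1.2 : 'rV[R]_1) 0 0 in
           let w := rsubmx j.1.2 : 'rV[R]_n in
           let Y := lsubmx j.2 : 'M[R]_(m, 1) in
           let W := rsubmx j.2 : 'M[R]_(m, n) in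
           let p := pt x y (0 : 'rV[R]_k) in
           [/\ sdom sigma p,
               `|y| < eps,
               `|w - sfun sigma p| < eps &
               opnorm_on (graph0 k Y)
                 (fun u => proj_m u *m W - u *m slin sigma p) < eps]].

Definition Rha_solution (R : realType) m n k
    (sigma : jet_section R (m + 1 + k) n) (eps : R)
    (delta : 'rV[R]_m -> R) (h : 'rV[R]_m -> 'rV[R]_n) : Prop :=
  set_nbhs cube
    [set x | Rha sigma eps (j1 (fun x => row_mx (delta x)%:M (h x)) x)].

Definition convex_hull (R : realType) (V : lmodType R) (A : set V) : set V :=
  smallest (@convex_set R V) A.

(* P is an affine subspace of V and Omega a subset of P. *)
Definition ample_in (R : realType) (V : normedModType R) (P Omega : set V) : Prop :=
  forall x, Omega x -> convex_hull (connected_component Omega x) = P.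

Definition principal_subspace (R : realType) a b (p : 'rV[R]_a) (q : 'rV[R]_b)
    (tau : {vspace 'rV[R]_a}) (L : {linear subvs_of tau -> 'rV[R]_b}) :
  set (jet R a b) :=
  [set j | [/\ j.1.1 = p, j.1.2 = q &
               forall v : subvs_of tau, vsval v *m j.2 = L v]].

Definition ample_relation (R : realType) a b (Rel : set (jet R a b)) : Prop :=
  forall (p : 'rV[R]_a) (q : 'rV[R]_b) (tau : {vspace 'rV[R]_a})
         (L : {linear subvs_of tau -> 'rV[R]_b}),
    (\dim tau).+1 = a ->
    ample_in (principal_subspace p q L) (Rel `&` principal_subspace p q L).

(* Main.v *)
Require Import Defs.
From HB Require Import structures.
From mathcomp Require Import all_boot all_order all_algebra.
From mathcomp Require Import all_classical all_reals all_analysis.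
From mathcomp Require Import ring lra.
Import numFieldNormedType.Exports.
Local Open Scope classical_set_scope.
Local Open Scope ring_scope.
Set Implicit Arguments.
Unset Strict Implicit.
Unset Printing Implicit Defensive.
Import Order.TTheory GRing.Theory Num.Theory.

(** Everything rests on one reformulation of the relation ([RhaP]).  The vectors
    of the graph of [Y] are the [v *m graph_mx Y], and on such a vector the map
    compared with zero is [v |-> v *m graph_gap p Y W].  An operator norm is
    smaller than [eps] exactly when some [alpha < eps] bounds the map against
    the Euclidean norm ([opnorm_onP]), so the last condition reads
    [`|v *m graph_gap p Y W| <= alpha * enorm (v *m graph_mx Y)] for all [v].
    The constant [alpha] is what makes perturbations possible without any
    compactness argument; openness ([open_Rha]) follows directly.

    From a solution [f1] to the relation ([Rha_of_extension]): [f1] restricted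
    to the deformed cell is [h] over the cube only, but every point of the cube
    can be left in each coordinate direction, at least on one side, while
    staying in the cube; hence [h] and [f1] along the cell have the same
    derivative, even at the boundary.  The error of [f1] restricted to the
    tangent space of the cell is then the gap of [h].  This gives the relation
    on the cube, and openness spreads it to a neighborhood.

    From the relation to a solution ([extension_of_Rha]): [h] is extended by an
    affine function of the normal coordinates whose derivative agrees with that
    of [sigma] on the orthogonal complement of the tangent space of the cell.
    The error then vanishes on that complement, so its operator norm is the
    norm of its restriction to the tangent space, which the relation bounds.
    Compactness of the cell turns these pointwise strict bounds into uniform
    ones on a compact neighborhood.

    Ampleness ([ample_Rha]): let [xi] be a unit normal of the hyperplane.  After
    an affine change of coordinates [(a, b)] on the principal subspace, [a]
    being the slope of [Y] along [xi], the bound becomes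
    [`|u *m A + lambda *: b| <=
      alpha * sqrt (N u ^+ 2 + lambda ^+ 2 * (1 + kappa * a ^+ 2))]
    for [u] in the hyperplane and [lambda] real, with [kappa > 0].  Shrinking
    [b] preserves it; for [b = 0] it does not depend on [a]; and, if it holds
    somewhere, then every given [b] satisfies it, for a larger [alpha < eps],
    once [`|a|] is large.  So the slice is connected, and each [(a, b)] is the
    midpoint of the two elements [(a + s, b)] and [(a - s, b)] of the slice, for
    [s] large ([slice_bound_shrink], [slice_bound_axis], [slice_bound_far] and
    [ample_of_axis]). *)

(** * Continuity of matrix operations *)

Section MatrixTopology.
Variable R : realType.

Lemma cvg_mxP (T : Type) (F : set_system T) {FF : Filter F} a b
    (f : T -> 'M[R]_(a, b)) (l : 'M[R]_(a, b)) :
  (forall i j, f x i j @[x --> F] --> l i j) -> f @ F --> l.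
Proof.
move=> fl; apply/cvgrPdist_le => e e0; near=> x.
rewrite [leLHS]/Num.norm/= mx_normrE (bigmax_le _ (ltW e0))//= => -[i j] _.
rewrite !mxE/=; move: i j; near: x.
apply: filter_forall => i; apply: filter_forall => j.
exact: ((cvgrPdist_le _ _).1 (fl i j)).
Unshelve. all: by end_near. Qed.

Lemma cvg_sum (V : normedModType R) (T I : Type) (F : set_system T)
    {FF : Filter F} (r : seq I) (f : I -> T -> V) (l : I -> V) :
  (forall i, f i @ F --> l i) ->
  (fun x => \sum_(i <- r) f i x) @ F --> \sum_(i <- r) l i.
Proof. by move=> fl; apply: cvg_big => [|i _//]; exact: add_continuous. Qed.

Lemma linear_mx_continuous a b (W : normedModType R)
  (L : {linear 'M[R]_(a, b) -> W}) : continuous L.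
Proof.
move=> M.
have LE N : L N = \sum_i \sum_j N i j *: L (delta_mx i j).
  rewrite [in LHS](matrix_sum_delta N) linear_sum; apply: eq_bigr => i _.
  by rewrite linear_sum; apply: eq_bigr => j _; rewrite linearZ.
have -> : (L : 'M[R]_(a, b) -> W) =
    fun N => \sum_i \sum_j N i j *: L (delta_mx i j) by apply/funext.
apply: (@cvg_sum _ _ _ (nbhs M)) => i; apply: cvg_sum => j.
by apply: cvgZr_tmp; exact: coord_continuous.
Qed.

Lemma mulmx_cvg (T : Type) (F : set_system T) {FF : Filter F} a b c
    (f : T -> 'M[R]_(a, b)) (g : T -> 'M[R]_(b, c)) (A : 'M[R]_(a, b)) (B : 'M[R]_(b, c)) :
  f @ F --> A -> g @ F --> B -> (fun x => f x *m g x) @ F --> A *m B.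
Proof.
move=> fA gB; apply: cvg_mxP => i j.
under eq_cvg do rewrite mxE.
rewrite mxE; apply: (@cvg_sum _ _ _ F) => k.
have fik : (fun x => f x i k) @ F --> A i k.
  exact: (cvg_comp f (fun M => M i k) fA (@coord_continuous R _ _ i k A)).
have gkj : (fun x => g x k j) @ F --> B k j.
  exact: (cvg_comp g (fun M => M k j) gB (@coord_continuous R _ _ k j B)).
exact: cvgM.
Qed.

Lemma mulmx_continuous a b c :
  continuous (fun p : 'M[R]_(a, b) * 'M[R]_(b, c) => p.1 *m p.2).
Proof. by move=> p; apply: mulmx_cvg; [exact: cvg_fst|exact: cvg_snd]. Qed.

End MatrixTopology.

(** * Calculus of smooth functions *)

Section Smooth.
Variable R : realType.

Definition mxcoord a b (i : 'I_a) (j : 'I_b) (M : 'M[R]_(a, b)) : R := M i j.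

Lemma mxcoord_is_linear a b i j : linear (@mxcoord a b i j).
Proof. by move=> k M N; rewrite /mxcoord !mxE. Qed.

HB.instance Definition _ a b i j :=
  GRing.isLinear.Build R 'M[R]_(a, b) R _ (mxcoord i j) (mxcoord_is_linear i j).

(** Needed because [Ck_on] iterates derivatives: two functions that agree on an
    open set must be interchangeable at every order. *)
Lemma near_eq_differentiable (V W : normedModType R) (f g : V -> W) (x : V) :
  (\near x, f x = g x) -> differentiable f x -> differentiable g x.
Proof.
move=> fg /diff_locallyP[dfc dfo].
have fgx : f x = g x := nbhs_singleton fg.
suff go : g \o shift x = cst (g x) + 'd f x +o_ 0 id.
  apply/diff_locallyP.
  by rewrite (diff_unique dfc go); split.
apply/eqaddoP => _/posnumP[e].
move/eqaddoP : dfo => /(_ _ [gt0 of e%:num]).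
apply: filterS2; last first.
  have := fg; rewrite (near_shift 0 x) subr0; exact.
by move=> y /= fgy; rewrite !fctE/= fgy fgx.
Qed.

Lemma Ck_on_eq (V W : normedModType R) r (U : set V) (f g : V -> W) :
  open U -> (forall p, U p -> f p = g p) -> Ck_on r U f -> Ck_on r U g.
Proof.
move=> oU; elim: r f g => [|r IHr] f g fg.
  move=> cf p Up; rewrite /prop_for /continuous_at -(fg _ Up).
  apply: cvg_trans (cf p Up); apply: near_eq_cvg.
  by apply: filterS fg _; exact: open_nbhs_nbhs.
have fgn p : U p -> \near p, f p = g p.
  by move=> Up; apply: filterS fg _; exact: open_nbhs_nbhs.
move=> [df Df]; split.
  by move=> p Up; exact: near_eq_differentiable (fgn p Up) (df p Up).
move=> v; apply: IHr (Df v) => p Up.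
exact: near_eq_derive (fgn p Up).
Qed.

Lemma Ck_onW (V W : normedModType R) r (U : set V) (f : V -> W) :
  Ck_on r.+1 U f -> Ck_on r U f.
Proof.
elim: r f => [|r IHr] f [df Df].
  by move=> p Up; exact: differentiable_continuous (df p Up).
by split=> // v; exact: IHr (Df v).
Qed.

Lemma Ck_on_sub (V W : normedModType R) r (U U' : set V) (f : V -> W) :
  U' `<=` U -> Ck_on r U f -> Ck_on r U' f.
Proof.
move=> sU; elim: r f => [|r IHr] f; first by move=> cf p /sU; exact: cf.
by move=> [df Df]; split=> [p /sU|v]; [exact: df|exact: IHr (Df v)].
Qed.

Lemma Ck_on_cst (V W : normedModType R) r (U : set V) (c : W) :
  Ck_on r U (fun=> c).
Proof.
elim: r c => [|r IHr] c; first by move=> p _; exact: cvg_cst.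
split; first by move=> p _; exact: (differentiable_cst c).
move=> v; suff -> : 'D_v (fun=> c) = (fun=> 0) :> (V -> W) by exact: IHr.
by apply/funext => p; exact: derive_cst.
Qed.

Lemma Ck_on_add (V W : normedModType R) r (U : set V) (f g : V -> W) :
  open U -> Ck_on r U f -> Ck_on r U g -> Ck_on r U (fun p => f p + g p).
Proof.
move=> oU; elim: r f g => [|r IHr] f g.
  by move=> cf cg p Up; apply: cvgD; [exact: cf|exact: cg].
move=> [df Df] [dg Dg]; split.
  by move=> p Up; apply: differentiableD; [exact: df|exact: dg].
move=> v; apply: Ck_on_eq (IHr _ _ (Df v) (Dg v)) => // p Up.
by rewrite -deriveD//; apply: diff_derivable; [exact: df|exact: dg].
Qed.

Lemma Ck_on_sum (V W : normedModType R) r (U : set V) (I : Type) (s : seq I)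
    (f : I -> V -> W) :
  open U -> (forall i, Ck_on r U (f i)) ->
  Ck_on r U (fun p => \sum_(i <- s) f i p).
Proof.
move=> oU cf; elim: s => [|i s IHs].
  by apply: Ck_on_eq (Ck_on_cst r U 0) => // p _; rewrite big_nil.
apply: Ck_on_eq (Ck_on_add oU (cf i) IHs) => // p _.
by rewrite big_cons.
Qed.

Lemma derive_linear (V W Z : normedModType R) (f : V -> W)
    (L : {linear W -> Z}) p v :
  continuous L -> differentiable f p ->
  'D_v (fun q => L (f q)) p = L ('D_v f p).
Proof.
move=> cL df.
have dL : differentiable L (f p) by exact: linear_differentiable.
rewrite deriveE; last exact: differentiable_comp df dL.
by rewrite (diff_comp df dL) /= diff_lin// -deriveE.
Qed.

Lemma Ck_on_linear (V W Z : normedModType R) r (U : set V) (f : V -> W)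
    (L : {linear W -> Z}) :
  open U -> continuous L -> Ck_on r U f -> Ck_on r U (fun p => L (f p)).
Proof.
move=> oU cL; elim: r f => [|r IHr] f.
  by move=> cf p Up; apply: continuous_comp; [exact: cf|exact: cL].
move=> [df Df]; split.
  move=> p Up; apply: differentiable_comp; first exact: df.
  exact: linear_differentiable.
move=> v; apply: Ck_on_eq (IHr _ (Df v)) => // p Up.
by rewrite derive_linear//; exact: df.
Qed.

Lemma differentiable_bilinear (V W1 W2 Z : normedModType R)
    (B : {bilinear W1 -> W2 -> Z}) (f : V -> W1) (g : V -> W2) p :
  continuous (fun q => B q.1 q.2) -> differentiable f p -> differentiable g p ->
  differentiable (fun p => B (f p) (g p)) p.
Proof.
move=> cB df dg.
have dB q : differentiable (fun q => B q.1 q.2) q by exact: differentiable_bilin.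
exact: (differentiable_comp (differentiable_pair df dg) (dB _)).
Qed.

Lemma derive_bilinear (V W1 W2 Z : normedModType R)
    (B : {bilinear W1 -> W2 -> Z}) (f : V -> W1) (g : V -> W2) p v :
  continuous (fun q => B q.1 q.2) -> differentiable f p -> differentiable g p ->
  'D_v (fun p => B (f p) (g p)) p = B (f p) ('D_v g p) + B ('D_v f p) (g p).
Proof.
move=> cB df dg.
have dB q : differentiable (fun q => B q.1 q.2) q by exact: differentiable_bilin.
rewrite deriveE; last exact: differentiable_bilinear.
rewrite (diff_comp (differentiable_pair df dg) (dB _) : _ = _ :> (_ -> _)) /=.
by rewrite (diff_bilin _ cB) (diff_pair df dg) /= -!deriveE.
Qed.

(** Leibniz rule: the derivative of [B (f p) (g p)] is a sum of two terms of the
    same shape, each with one factor replaced by its derivative. *)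
Lemma Ck_on_bilinear (V W1 W2 Z : normedModType R) r (U : set V)
    (B : {bilinear W1 -> W2 -> Z}) (f : V -> W1) (g : V -> W2) :
  open U -> continuous (fun q => B q.1 q.2) ->
  Ck_on r U f -> Ck_on r U g -> Ck_on r U (fun p => B (f p) (g p)).
Proof.
move=> oU cB; elim: r f g => [|r IHr] f g.
  move=> cf cg p Up.
  apply: (@continuous2_cvg _ _ _ _ _ _ f g B (f p) (g p)) => //.
  - exact: (cB (f p, g p)).
  - exact: cf.
  - exact: cg.
move=> cf' cg'; have cf := Ck_onW cf'; have cg := Ck_onW cg'.
case: cf' cg' => [df Df] [dg Dg]; split=> [p Up|v].
  by apply: differentiable_bilinear => //; [exact: df|exact: dg].
apply: Ck_on_eq (Ck_on_add oU (IHr _ _ cf (Dg v)) (IHr _ _ (Df v) cg)) => // p Up.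
by rewrite derive_bilinear//; [exact: df|exact: dg].
Qed.

Lemma mulmx_is_bilinear a b c : bilinear_for
  (GRing.Scale.Law.clone _ _ *:%R _) (GRing.Scale.Law.clone _ _ *:%R _)
  (@mulmx R a b c).
Proof.
split=> [B|A] k x y /=; first by rewrite mulmxDl scalemxAl.
by rewrite mulmxDr scalemxAr.
Qed.

HB.instance Definition _ a b c :=
  bilinear_isBilinear.Build R 'M[R]_(a, b) 'M[R]_(b, c) 'M[R]_(a, c) _ _
    (@mulmx R a b c) (mulmx_is_bilinear a b c).

Lemma differentiable_mulmx (V : normedModType R) a b c
    (f : V -> 'M[R]_(a, b)) (g : V -> 'M[R]_(b, c)) p :
  differentiable f p -> differentiable g p ->
  differentiable (fun p => f p *m g p) p.
Proof. by apply: differentiable_bilinear; exact: mulmx_continuous. Qed.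

Lemma derive_mulmx (V : normedModType R) a b c
    (f : V -> 'M[R]_(a, b)) (g : V -> 'M[R]_(b, c)) p v :
  differentiable f p -> differentiable g p ->
  'D_v (fun p => f p *m g p) p = f p *m 'D_v g p + 'D_v f p *m g p.
Proof. by apply: derive_bilinear; exact: mulmx_continuous. Qed.

Lemma Ck_on_mulmx (V : normedModType R) r (U : set V) a b c
    (f : V -> 'M[R]_(a, b)) (g : V -> 'M[R]_(b, c)) :
  open U -> Ck_on r U f -> Ck_on r U g -> Ck_on r U (fun p => f p *m g p).
Proof. by move=> oU; apply: Ck_on_bilinear => //; exact: mulmx_continuous. Qed.

Lemma scale_is_bilinear (W : normedModType R) : bilinear_for
  (GRing.Scale.Law.clone _ _ *:%R _) (GRing.Scale.Law.clone _ _ *:%R _)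
  (@GRing.scale R W : R -> W -> W).
Proof.
split=> [w|t] k x y /=; first by rewrite scalerDl -scalerA.
by rewrite scalerDr !scalerA mulrC.
Qed.

HB.instance Definition _ (W : normedModType R) :=
  bilinear_isBilinear.Build R R W W _ _
    (@GRing.scale R W : R -> W -> W) (scale_is_bilinear W).

Lemma Ck_on_scale (V W : normedModType R) r (U : set V)
    (f : V -> R) (g : V -> W) :
  open U -> Ck_on r U f -> Ck_on r U g -> Ck_on r U (fun p => f p *: g p).
Proof.
move=> oU; apply: (Ck_on_bilinear (B := (@GRing.scale R W : R -> W -> W))) => //.
exact: scale_continuous.
Qed.

Lemma Ck_on_opp (V W : normedModType R) r (U : set V) (f : V -> W) :
  open U -> Ck_on r U f -> Ck_on r U (fun p => - f p).
Proof.
move=> oU cf; apply: Ck_on_eq (Ck_on_scale oU (Ck_on_cst r U (-1 : R)) cf) => //.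
by move=> p _; rewrite scaleN1r.
Qed.

(** The derivative of [f^-1] is [- f^-1 * f^-1 * f'], which involves [f^-1] itself
    but one order lower. *)
Lemma Ck_on_inv (V : normedModType R) r (U : set V) (f : V -> R) :
  open U -> (forall p, U p -> f p != 0) ->
  Ck_on r U f -> Ck_on r U (fun p => (f p)^-1).
Proof.
move=> oU f0; elim: r => [|r IHr].
  by move=> cf p Up; apply: cvgV; [exact: f0|exact: cf].
move=> cf'; have cV := IHr (Ck_onW cf'); case: cf' => [df Df].
split=> [p Up|v]; first by apply: differentiableV; [exact: df|exact: f0].
have := Ck_on_scale oU (Ck_on_scale oU cV cV) (Ck_on_scale oU (Ck_on_cst r U (-1 : R)) (Df v)).
apply: Ck_on_eq => // p Up.
rewrite deriveV; [|exact: f0|exact/diff_derivable/df].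
rewrite /GRing.scale/=; field; exact: f0.
Qed.

Lemma derive_comp (V W Z : normedModType R) (f : W -> Z) (g : V -> W) p v :
  differentiable g p -> differentiable f (g p) ->
  'D_v (fun q => f (g q)) p = 'D_('D_v g p) f (g p).
Proof.
move=> dg df; rewrite deriveE; last exact: differentiable_comp dg df.
by rewrite (diff_comp dg df) /= -!deriveE.
Qed.

Lemma derive_sum_coord (W : normedModType R) d (f : 'rV[R]_d -> W) q v :
  differentiable f q ->
  'D_v f q = \sum_i v 0 i *: 'D_(delta_mx 0 i) f q.
Proof.
move=> df; rewrite deriveE// [in LHS](row_sum_delta v) linear_sum.
by apply: eq_bigr => i _; rewrite linearZ deriveE.
Qed.

(** The inner function takes values in a space of row vectors so that the chain
    rule can be expanded in coordinates ([derive_sum_coord]): only derivatives of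
    [f] in the fixed directions of the basis occur, and the induction applies to
    them. *)
Lemma Ck_on_comp (V W : normedModType R) d r (U : set V) (O : set 'rV[R]_d)
    (f : 'rV[R]_d -> W) (g : V -> 'rV[R]_d) :
  open U -> (forall p, U p -> O (g p)) ->
  Ck_on r O f -> Ck_on r U g -> Ck_on r U (fun p => f (g p)).
Proof.
move=> oU gUO; elim: r f => [|r IHr] f.
  move=> cf cg p Up; apply: continuous_comp; first exact: cg.
  exact: cf (gUO _ Up).
move=> [df Df] cg'; have cg := Ck_onW cg'; case: cg' => [dg Dg].
split=> [p Up|v].
  by apply: differentiable_comp; [exact: dg|exact/df/gUO].
have := Ck_on_sum (index_enum 'I_d) oU (fun i => Ck_on_scale oU
  (Ck_on_linear oU (@linear_mx_continuous _ _ _ _ (mxcoord 0 i)) (Dg v)) (IHr _ (Df (delta_mx 0 i)) cg)).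
apply: Ck_on_eq => // p Up.
have dfg : differentiable f (g p) by exact/df/gUO.
have dgp := dg p Up.
rewrite [RHS](derive_comp v dgp dfg).
by rewrite [RHS](derive_sum_coord _ dfg).
Qed.

Lemma Ck_on_id (V : normedModType R) r (U : set V) : Ck_on r U (fun p => p).
Proof.
case: r => [|r]; first by move=> p _; exact: cvg_id.
split=> [p _|v]; first exact: ex_diff.
suff -> : 'D_v (fun p : V => p) = (fun=> v) by exact: Ck_on_cst.
by apply/funext => p; exact: derive_id.
Qed.

Lemma Ck_on_jacobian a b r (U : set 'rV[R]_a) (f : 'rV[R]_a -> 'rV[R]_b) :
  open U -> Ck_on r.+1 U f -> Ck_on r U (jacobian f).
Proof.
move=> oU [df Df].
have := Ck_on_sum (index_enum 'I_a) oU (fun i => Ck_on_mulmx oU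
  (Ck_on_cst r U (delta_mx i 0 : 'cV[R]_a)) (Df (delta_mx 0 i))).
apply: Ck_on_eq => // p Up.
under eq_bigr do rewrite (deriveEjacobian _ (df _ Up)) -rowE.
apply/matrixP => i j; rewrite summxE (bigD1 i)//= big1 => [|l li].
  by rewrite addr0 mxE big_ord1 !mxE !eqxx mul1r.
by rewrite mxE big_ord1 !mxE eq_sym (negbTE li) mul0r.
Qed.

End Smooth.

(** * Euclidean and operator norms *)

Section Norms.
Variable R : realType.

Lemma enorm_ge0 d (v : 'rV[R]_d) : 0 <= enorm v.
Proof. exact: sqrtr_ge0. Qed.

Lemma sqr_enorm d (v : 'rV[R]_d) : enorm v ^+ 2 = \sum_i v 0 i ^+ 2.
Proof. by rewrite sqr_sqrtr// sumr_ge0// => i _; exact: sqr_ge0. Qed.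

Lemma sqr_enormE d (v : 'rV[R]_d) : (enorm v ^+ 2)%:M = v *m v^T.
Proof.
apply/matrixP => i j; rewrite !ord1 !mxE mulr1n sqr_enorm.
by apply: eq_bigr => l _; rewrite mxE expr2.
Qed.

Lemma sqr_enormD d (u w : 'rV[R]_d) :
  enorm (u + w) ^+ 2 = enorm u ^+ 2 + (u *m w^T) 0 0 *+ 2 + enorm w ^+ 2.
Proof.
rewrite !sqr_enorm mxE -sumrMnl -!big_split/=; apply: eq_bigr => i _.
by rewrite !mxE sqrrD.
Qed.

Lemma enormZ d (c : R) (v : 'rV[R]_d) : enorm (c *: v) = `|c| * enorm v.
Proof.
rewrite /enorm -sqrtr_sqr -sqrtrM ?sqr_ge0// mulr_sumr; congr Num.sqrt.
by apply: eq_bigr => i _; rewrite mxE exprMn.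
Qed.

Lemma enorm0 d : enorm (0 : 'rV[R]_d) = 0.
Proof. by rewrite -(scale0r (0 : 'rV[R]_d)) enormZ normr0 mul0r. Qed.

Lemma norm_le_enorm d (v : 'rV[R]_d) : `|v| <= enorm v.
Proof.
rewrite [leLHS]/Num.norm/= mx_normrE (bigmax_le _ (enorm_ge0 v))//= => -[i j] _ /=.
rewrite ord1 -(ger0_norm (enorm_ge0 v)) -ler_sqr ?nnegrE// real_normK ?num_real//.
rewrite real_normK ?num_real// sqr_enorm (bigD1 j)//= lerDl sumr_ge0// => l _.
exact: sqr_ge0.
Qed.

Lemma enorm_eq0 d (v : 'rV[R]_d) : enorm v = 0 -> v = 0.
Proof.
by move=> v0; apply/eqP; rewrite -normr_le0 -v0 norm_le_enorm.
Qed.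

Lemma norm_entry_le a b (N : 'M[R]_(a, b)) i j : `|N i j| <= `|N|.
Proof. by rewrite [leRHS]/Num.norm/= mx_normrE; exact: (le_bigmax _ _ (i, j)). Qed.

Lemma norm_mulmx_le a b c (A : 'M[R]_(a, b)) (M : 'M[R]_(b, c)) :
  `|A *m M| <= b%:R * `|A| * `|M|.
Proof.
rewrite [leLHS]/Num.norm/= mx_normrE.
apply: bigmax_le => /= [|[i j] _]; first by rewrite !mulr_ge0.
rewrite mxE (le_trans (ler_norm_sum _ _ _))//.
rewrite (@le_trans _ _ (\sum_(l < b) `|A| * `|M|))//.
  by apply: ler_sum => l _; rewrite normrM ler_pM// ; exact: norm_entry_le.
by rewrite sumr_const card_ord -mulrA mulr_natl.
Qed.

(** Homogeneity turns the supremum over the unit ball into an inequality for all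
    vectors of the cone; the supremum itself serves as [alpha]. *)
Lemma opnorm_onP a b (S : set 'rV[R]_a) (M : 'M[R]_(a, b)) (e : R) :
  S 0 -> (forall c u, S u -> S (c *: u)) ->
  opnorm_on S (mulmx^~ M) < e <->
  exists alpha, [/\ 0 <= alpha, alpha < e &
    forall u, S u -> `|u *m M| <= alpha * enorm u].
Proof.
move=> S0 SZ; set X := [set `|u *m M| | u in [set u | S u /\ enorm u <= 1]].
have X0 : X 0 by exists 0; rewrite /= ?mul0mx ?normr0// enorm0; split.
split=> [Xe|[alpha [alpha0 alphae H]]]; last first.
  apply: le_lt_trans alphae; apply: ge_sup; first by exists 0.
  move=> _ [u [Su u1] <-]; apply: le_trans (H u Su) _.
  by rewrite ler_piMr.
have hX : has_sup X.
  split; first by exists 0.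
  exists (a%:R * `|M|) => _ [u [Su u1] <-].
  rewrite (le_trans (norm_mulmx_le _ _))// ler_wpM2r// ler_piMr//.
  exact: le_trans (norm_le_enorm u) u1.
exists (sup X); split => //; first exact: sup_upper_bound.
move=> u Su; have [u0|u0] := eqVneq (enorm u) 0.
  by rewrite u0 (enorm_eq0 u0) mul0mx normr0 mulr0.
have up : 0 < enorm u by rewrite lt_def u0 enorm_ge0.
rewrite -ler_pdivrMr//.
apply: sup_upper_bound => //; exists ((enorm u)^-1 *: u).
  split; first exact: SZ.
  by rewrite enormZ ger0_norm ?invr_ge0 ?enorm_ge0// mulVf.
by rewrite -scalemxAl normrZ ger0_norm ?invr_ge0 ?enorm_ge0// mulrC.
Qed.

End Norms.

(** * The relation as a bound over the graph *)

Section GraphMatrix.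
Variables (R : realType) (m k : nat).

(** The inclusions of the three factors: [v *m inx], [v *m iny] and [v *m inz] are
    [v] placed in the corresponding block. *)
Definition inx : 'M[R]_(m, m + 1 + k) := row_mx (row_mx 1%:M 0) 0.
Definition iny : 'M[R]_(1, m + 1 + k) := row_mx (row_mx 0 1%:M) 0.
Definition inz : 'M[R]_(k, m + 1 + k) := row_mx 0 1%:M.
Definition graph_mx (Y : 'M[R]_(m, 1)) := inx + Y *m iny.

Lemma ptE (x : 'rV[R]_m) y (z : 'rV[R]_k) :
  pt x y z = x *m inx + y%:M *m iny + z *m inz.
Proof.
rewrite /inx /iny /inz /pt !mul_mx_row !mulmx1 !mulmx0.
by rewrite !add_row_mx !(addr0, add0r).
Qed.

Lemma mul_graph_mx (Y : 'M[R]_(m, 1)) (v : 'rV[R]_m) :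
  v *m graph_mx Y = pt v ((v *m Y) 0 0) 0.
Proof.
by rewrite ptE mul0mx addr0 /graph_mx mulmxDr mulmxA -mx11_scalar.
Qed.

Lemma sqr_enorm_pt (x : 'rV[R]_m) y (z : 'rV[R]_k) :
  enorm (pt x y z) ^+ 2 = enorm x ^+ 2 + y ^+ 2 + enorm z ^+ 2.
Proof.
rewrite !sqr_enorm !big_split_ord/=; congr (_ + _ + _).
- by apply: eq_bigr => i _; rewrite /pt !row_mxEl.
- by rewrite big_ord1 /pt row_mxEl row_mxEr mxE mulr1n.
- by apply: eq_bigr => i _; rewrite /pt row_mxEr.
Qed.

Lemma enorm_le_graph (Y : 'M[R]_(m, 1)) v : enorm v <= enorm (v *m graph_mx Y).
Proof.
rewrite -ler_sqr ?nnegrE ?enorm_ge0// mul_graph_mx sqr_enorm_pt.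
by rewrite -addrA lerDl addr_ge0 ?sqr_ge0.
Qed.

Lemma enorm_graph_perturb (Y Y' : 'M[R]_(m, 1)) v :
  enorm (v *m graph_mx Y) <=
  enorm (v *m graph_mx Y') + `|v *m (Y - Y')|.
Proof.
set t := `|_|.
have t0 : 0 <= t by exact: normr_ge0.
have tE : `|(v *m Y) 0 0 - (v *m Y') 0 0| <= t.
  by have := norm_entry_le (v *m (Y - Y')) 0 0; rewrite [in leLHS]mulmxBr mxE [X in _ + X]mxE.
set E := enorm (_ *m graph_mx Y'); set y := (v *m Y) 0 0; set y' := (v *m Y') 0 0.
have E0 : 0 <= E by exact: enorm_ge0.
rewrite -ler_sqr ?nnegrE ?enorm_ge0 ?addr_ge0//.
have -> : enorm (v *m graph_mx Y) ^+ 2 = E ^+ 2 - y' ^+ 2 + y ^+ 2.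
  by rewrite /E !mul_graph_mx !sqr_enorm_pt -/y -/y' enorm0; ring.
have y'E : `|y'| <= E.
  rewrite -ler_sqr ?nnegrE// /E mul_graph_mx sqr_enorm_pt -/y' real_normK ?num_real//.
  by rewrite enorm0 expr0n/= addr0 lerDr sqr_ge0.
rewrite sqrrD.
have yy' : y' * (y - y') <= E * t.
  by rewrite (le_trans (ler_norm _))// normrM ler_pM.
have : (y - y') ^+ 2 <= t ^+ 2.
  by rewrite -[(y - y') ^+ 2]real_normK ?num_real// ler_sqr ?nnegrE.
by rewrite mulr2n; nra.
Qed.

(** The norm of [v *m graph_mx Y'] dominates that of [v], which absorbs both the
    error on [A] and the one on the graph. *)
Lemma graph_bound_open n (Y : 'M[R]_(m, 1)) (A : 'M[R]_(m, n)) (alpha eps : R) :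
  0 <= alpha -> alpha < eps ->
  (forall v, `|v *m A| <= alpha * enorm (v *m graph_mx Y)) ->
  exists2 d, 0 < d & forall Y' A', `|Y - Y'| < d -> `|A - A'| < d ->
    exists alpha', [/\ 0 <= alpha', alpha' < eps &
      forall v, `|v *m A'| <= alpha' * enorm (v *m graph_mx Y')].
Proof.
move=> alpha0 alphae H.
have q0 : 0 < m.+1%:R * (alpha + 1) by rewrite mulr_gt0// ltr_wpDl.
have [d d_gt0 dE] : exists2 d, 0 < d & d * (m.+1%:R * (alpha + 1)) = eps - alpha.
  exists ((eps - alpha) / (m.+1%:R * (alpha + 1))); first by rewrite divr_gt0 ?subr_gt0.
  by rewrite divfK// gt_eqF.
have d0 := ltW d_gt0; exists d => // Y' A' dY dA.
exists (alpha + m%:R * d * (alpha + 1)); split.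
- by rewrite addr_ge0// mulr_ge0// ?addr_ge0// mulr_ge0.
- have : 0 < d * (alpha + 1) by rewrite mulr_gt0// ltr_wpDl.
  by move: dE; rewrite -natr1; nra.
move=> v; set E' := enorm (v *m graph_mx Y').
have small p (N : 'M[R]_(m, p)) : `|N| < d -> `|v *m N| <= m%:R * d * E'.
  move=> Nd; rewrite (le_trans (norm_mulmx_le _ _))// -!mulrA ler_wpM2l//.
  rewrite mulrC ler_pM// ?(ltW Nd)//.
  exact: le_trans (norm_le_enorm v) (enorm_le_graph _ _).
have -> : v *m A' = v *m A - v *m (A - A') by rewrite mulmxBr subKr.
rewrite (le_trans (ler_normB _ _))//.
have h1 := H v; have h2 := small _ _ dA; have h3 := small _ _ dY.
have h4 := enorm_graph_perturb Y Y' v.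
have : alpha * enorm (v *m graph_mx Y) <= alpha * (E' + m%:R * d * E').
  by rewrite ler_wpM2l// (le_trans h4)// lerD2l.
by move: h1 h2; rewrite -/E'; nra.
Qed.

Lemma graph0_0 (Y : 'M[R]_(m, 1)) : graph0 k Y 0.
Proof. by exists 0 => //; rewrite -mul_graph_mx mul0mx. Qed.

Lemma graph0_scale (Y : 'M[R]_(m, 1)) c u :
  graph0 k Y u -> graph0 k Y (c *: u).
Proof.
move=> [v _ <-]; exists (c *: v) => //.
by rewrite -!mul_graph_mx scalemxAl.
Qed.

Definition projx : 'M[R]_(m + 1 + k, m) := col_mx (col_mx 1%:M 0) 0.

Lemma proj_mE (u : 'rV[R]_(m + 1 + k)) : proj_m u = u *m projx.
Proof.
rewrite /projx -[u]hsubmxK mul_row_col mulmx0 addr0 -[lsubmx u]hsubmxK.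
by rewrite mul_row_col mulmx0 addr0 mulmx1 /proj_m !row_mxKl.
Qed.

Lemma graph_mx_projx Y : graph_mx Y *m projx = 1%:M.
Proof.
rewrite /graph_mx /inx /iny /projx mulmxDl -mulmxA !mul_row_col.
by rewrite !mulmx0 !mul0mx !mulmx1 !addr0 mulmx0 addr0.
Qed.

Variables (n : nat) (sigma : jet_section R (m + 1 + k) n) (eps : R).

(** The restriction of [W \o p_m - phi] to the graph, precomposed with the
    parametrization [v |-> v *m graph_mx Y]. *)
Definition graph_gap (p : 'rV[R]_(m + 1 + k)) (Y : 'M[R]_(m, 1))
    (W : 'M[R]_(m, n)) : 'M[R]_(m, n) := W - graph_mx Y *m slin sigma p.

(** Every vector of the graph is [v *m graph_mx Y] for a unique [v], and
    [graph_mx Y *m projx] is the identity. *)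
Lemma RhaP (j : jet R m (1 + n)) (p := pt j.1.1 (lsubmx j.1.2 0 0) 0) :
  Rha sigma eps j <->
  [/\ sdom sigma p, `|lsubmx j.1.2 0 0| < eps,
      `|rsubmx j.1.2 - Defs.sfun sigma p| < eps &
      exists alpha, [/\ 0 <= alpha, alpha < eps & forall v,
        `|v *m graph_gap p (lsubmx j.2) (rsubmx j.2)|
          <= alpha * enorm (v *m graph_mx (lsubmx j.2))]].
Proof.
set Y := lsubmx j.2; set W := rsubmx j.2.
have -> : Rha sigma eps j =
  [/\ sdom sigma p, `|lsubmx j.1.2 0 0| < eps,
      `|rsubmx j.1.2 - Defs.sfun sigma p| < eps &
      opnorm_on (graph0 k Y) (mulmx^~ (projx *m W - slin sigma p)) < eps].
  rewrite /Rha/= -/p -/Y -/W; congr [/\ _, _, _ & opnorm_on _ _ < _].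
  by apply/funext => u; rewrite proj_mE mulmxBr mulmxA.
have gapE v : v *m graph_mx Y *m (projx *m W - slin sigma p) =
    v *m graph_gap p Y W.
  by rewrite -mulmxA mulmxBr mulmxA graph_mx_projx mul1mx.
have opP := opnorm_onP (projx *m W - slin sigma p) eps (graph0_0 Y)
  (@graph0_scale Y).
split=> -[h1 h2 h3 h4]; split=> //.
  have [alpha [a0 ae H]] := opP.1 h4; exists alpha; split=> // v.
  by rewrite -gapE; apply: H; exists v => //; rewrite mul_graph_mx.
apply/opP; have [alpha [a0 ae H]] := h4; exists alpha; split=> // _ [v _ <-].
by rewrite -mul_graph_mx gapE.
Qed.

Lemma pt_cvg (T : Type) (F : set_system T) {FF : Filter F}
    (x : T -> 'rV[R]_m) (y : T -> R) (x0 : 'rV[R]_m) (y0 : R) :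
  x @ F --> x0 -> y @ F --> y0 ->
  (fun t => pt (x t) (y t) (0 : 'rV[R]_k)) @ F --> pt x0 y0 (0 : 'rV[R]_k).
Proof.
move=> xx0 yy0; rewrite ptE; under eq_cvg do rewrite ptE.
apply: cvgD; last exact: cvg_cst.
apply: cvgD; apply: mulmx_cvg; rewrite //; try exact: cvg_cst.
by apply: cvg_mxP => i j; rewrite !ord1 mxE mulr1n;
  under eq_cvg do rewrite mxE mulr1n.
Qed.

Lemma open_Rha : open (Rha sigma eps).
Proof.
rewrite openE => j Rj; rewrite /interior.
pose p (j : jet R m (1 + n)) := pt j.1.1 (lsubmx j.1.2 0 0) (0 : 'rV[R]_k).
have [h1 h2 h3 [alpha [a0 ae H]]] := (RhaP j).1 Rj.
have c11 : (fun i : jet R m (1 + n) => i.1.1) @ j --> j.1.1.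
  by apply: cvg_comp cvg_fst _; exact: cvg_fst.
have c12 : (fun i : jet R m (1 + n) => i.1.2) @ j --> j.1.2.
  by apply: cvg_comp cvg_fst _; exact: cvg_snd.
have c2 : (fun i : jet R m (1 + n) => i.2) @ j --> j.2 by exact: cvg_snd.
have cy : (fun i : jet R m (1 + n) => lsubmx i.1.2 0 0) @ j --> lsubmx j.1.2 0 0.
  apply: (cvg_comp _ (fun M : 'M[R]_(1, 1) => M 0 0)); last exact: coord_continuous.
  by apply: cvg_comp c12 _; exact: continuous_lsubmx.
have cw : (fun i : jet R m (1 + n) => rsubmx i.1.2) @ j --> rsubmx j.1.2.
  by apply: cvg_comp c12 _; exact: continuous_rsubmx.
have cY : (fun i : jet R m (1 + n) => lsubmx i.2) @ j --> lsubmx j.2.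
  by apply: cvg_comp c2 _; exact: continuous_lsubmx.
have cW : (fun i : jet R m (1 + n) => rsubmx i.2) @ j --> rsubmx j.2.
  by apply: cvg_comp c2 _; exact: continuous_rsubmx.
have cp : p @ j --> p j by exact: pt_cvg.
have cf : (fun i => Defs.sfun sigma (p i)) @ j --> Defs.sfun sigma (p j).
  by apply: cvg_comp cp _; exact: (sfun_smooth sigma 0).
have cS : (fun i => slin sigma (p i)) @ j --> slin sigma (p j).
  by apply: cvg_comp cp _; exact: (slin_smooth sigma 0).
have cG : (fun i => graph_gap (p i) (lsubmx i.2) (rsubmx i.2)) @ j -->
    graph_gap (p j) (lsubmx j.2) (rsubmx j.2).
  apply: cvgB => //; apply: mulmx_cvg => //.
  by apply: cvgD; [exact: cvg_cst|apply: mulmx_cvg => //; exact: cvg_cst].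
have [d d0 Hd] := graph_bound_open a0 ae H.
have n1 : \near j, sdom sigma (p j).
  by apply: cp; apply: open_nbhs_nbhs; split=> //; exact: sdom_open.
have n2 : \forall i \near j, `|lsubmx i.1.2 0 0| < eps.
  by move/cvg_norm : cy => /(_ _ (lt_nbhsl h2)).
have n3 : \forall i \near j, `|rsubmx i.1.2 - Defs.sfun sigma (p i)| < eps.
  have cwf : (fun i : jet R m (1 + n) => rsubmx i.1.2 - Defs.sfun sigma (p i)) @ j
    --> rsubmx j.1.2 - Defs.sfun sigma (p j) by exact: cvgB.
  by move/cvg_norm : cwf => /(_ _ (lt_nbhsl h3)).
have n4 : \forall i \near j, `|lsubmx j.2 - lsubmx i.2| < d.
  by move/cvgrPdist_lt : cY; exact.
have n5 : \forall i \near j, `|graph_gap (p j) (lsubmx j.2) (rsubmx j.2) -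
    graph_gap (p i) (lsubmx i.2) (rsubmx i.2)| < d.
  by move/cvgrPdist_lt : cG; exact.
near=> i; apply/RhaP; rewrite -/(p i); split.
- by near: i.
- by near: i.
- by near: i.
- by apply: Hd; near: i.
Unshelve. all: by end_near. Qed.

End GraphMatrix.

(** * Slices by principal subspaces *)

Section NormalForm.
Variables (R : realType) (m k n : nat).
Variables (xi : 'cV[R]_m) (Y : 'M[R]_(m, 1)) (A : 'M[R]_(m, n)).
Hypotheses (xi1 : xi^T *m xi = 1%:M) (xiY : xi^T *m Y = 0) (xiA : xi^T *m A = 0).

Let c := enorm Y^T ^+ 2.
Let kappa := (1 + c)^-1.

Let c_ge0 : 0 <= c. Proof. exact: sqr_ge0. Qed.
Let kappaE : kappa * (1 + c) = 1.
Proof. by rewrite mulVf// gt_eqF// ltr_pwDl. Qed.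
Let kappa_gt0 : 0 < kappa.
Proof. by rewrite invr_gt0 ltr_pwDl. Qed.

(** The vector of the line through [xi^T] in the direction of [Y^T] whose image
    under [graph_mx (slice_lin a)] is orthogonal to the graph over the
    hyperplane.  Replacing [xi^T] by it removes all cross terms from the norm
    ([sqr_enorm_slice]), whatever [a] is. *)
Definition slice_dir (a : R) : 'rV[R]_m := xi^T - (a * kappa) *: Y^T.
Definition slice_lin (a : R) : 'M[R]_(m, 1) := Y + a *: xi.
(** The gap along the slice when its elements have slope [slice_lin a]; the shift
    of [b] is chosen so that the image of [slice_dir a] is [b]
    ([mul_slice_gap]). *)
Definition slice_gap (a : R) (b : 'rV[R]_n) : 'M[R]_(m, n) :=
  A + xi *m (b + (a * kappa) *: (Y^T *m A)).

Let Yxi : Y^T *m xi = 0.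
Proof. by apply: trmx_inj; rewrite trmx_mul trmxK trmx0. Qed.

Let YY : Y^T *m Y = c%:M.
Proof. by rewrite /c sqr_enormE trmxK. Qed.

Lemma slice_dir_normal a : slice_dir a *m xi = 1%:M.
Proof. by rewrite /slice_dir mulmxBl xi1 -scalemxAl Yxi scaler0 subr0. Qed.

Lemma slice_decomposition a (v : 'rV[R]_m) : exists u lambda,
  u *m xi = 0 /\ v = u + lambda *: slice_dir a.
Proof.
exists (v - (v *m xi) 0 0 *: slice_dir a), ((v *m xi) 0 0).
by rewrite subrK mulmxBl -scalemxAl slice_dir_normal scalemx1 -mx11_scalar subrr.
Qed.

Lemma mul_slice_gap a b u lambda : u *m xi = 0 ->
  (u + lambda *: slice_dir a) *m slice_gap a b = u *m A + lambda *: b.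
Proof.
move=> uxi; rewrite mulmxDl -scalemxAl /slice_gap.
have [B BE] : exists B, B = b + (a * kappa) *: (Y^T *m A) by eexists.
rewrite -BE !mulmxDr !mulmxA uxi slice_dir_normal mul0mx mul1mx addr0.
rewrite /slice_dir mulmxBl xiA sub0r -scalemxAl BE; congr (_ + _ *: _).
by rewrite addrCA addNr addr0.
Qed.

Lemma sqr_enorm_slice a u lambda : u *m xi = 0 ->
  enorm ((u + lambda *: slice_dir a) *m graph_mx k (slice_lin a)) ^+ 2 =
  enorm (u *m graph_mx k Y) ^+ 2 + lambda ^+ 2 * (1 + a ^+ 2 * kappa).
Proof.
move=> uxi.
rewrite !mul_graph_mx !sqr_enorm_pt !enorm0 !expr0n/= !addr0.
set y := (u *m Y) 0 0.
have uw : (u *m (lambda *: slice_dir a)^T) 0 0 = - (lambda * (a * kappa) * y).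
  have -> : (lambda *: slice_dir a)^T = lambda *: (xi - (a * kappa) *: Y).
    by rewrite linearZ/= /slice_dir raddfB/= linearZ/= !trmxK.
  rewrite -scalemxAr mulmxBr uxi sub0r -scalemxAr /y.
  by move: (u *m Y) => M; rewrite !mxE; ring.
have wE : enorm (slice_dir a) ^+ 2 = 1 + (a * kappa) ^+ 2 * c.
  rewrite /slice_dir sqr_enormD -scaleNr enormZ exprMn real_normK ?num_real//.
  rewrite -/c linearZ/= trmxK -scalemxAr xiY scaler0 mxE mul0rn addr0 sqrrN.
  congr (_ + _); have := sqr_enormE xi^T; rewrite trmxK xi1.
  by move=> /matrixP/(_ 0 0); rewrite !mxE !mulr1n.
have vY : ((u + lambda *: slice_dir a) *m slice_lin a) 0 0 = y + lambda * a * kappa.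
  rewrite /slice_lin mulmxDr -scalemxAr !mulmxDl uxi add0r.
  rewrite -!scalemxAl slice_dir_normal /slice_dir mulmxBl xiY sub0r -scalemxAl YY.
  rewrite /y; move: (u *m Y) => M; rewrite !mxE !mulr1n.
  rewrite (_ : lambda * a * kappa = lambda * a * (kappa * (1 + c)) - lambda * a * kappa * c); last by ring.
  by rewrite kappaE; ring.
rewrite sqr_enormD uw enormZ exprMn real_normK ?num_real// wE vY.
rewrite mulr2n; transitivity (enorm u ^+ 2 + y ^+ 2 + lambda ^+ 2 *
  (1 + a ^+ 2 * kappa * (kappa * (1 + c)))); last by rewrite kappaE; ring.
ring.
Qed.

Variable eps : R.

Definition slice_bound a b := exists alpha, [/\ 0 <= alpha, alpha < eps &
  forall v, `|v *m slice_gap a b| <= alpha * enorm (v *m graph_mx k (slice_lin a))].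

(** The bound in the coordinates of [slice_decomposition]. *)
Let reduced alpha a b := forall u lambda, u *m xi = 0 ->
  `|u *m A + lambda *: b| <=
   alpha * Num.sqrt (enorm (u *m graph_mx k Y) ^+ 2 + lambda ^+ 2 * (1 + a ^+ 2 * kappa)).

Let reducedP alpha a b : (forall v, `|v *m slice_gap a b| <=
    alpha * enorm (v *m graph_mx k (slice_lin a))) <-> reduced alpha a b.
Proof.
have nE u lambda : u *m xi = 0 ->
    enorm ((u + lambda *: slice_dir a) *m graph_mx k (slice_lin a)) =
    Num.sqrt (enorm (u *m graph_mx k Y) ^+ 2 + lambda ^+ 2 * (1 + a ^+ 2 * kappa)).
  by move=> uxi; rewrite -sqr_enorm_slice// sqrtr_sqr ger0_norm// enorm_ge0.
split=> [H u lambda uxi|H v].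
  by have := H (u + lambda *: slice_dir a); rewrite mul_slice_gap// nE.
have [u [lambda [uxi ->]]] := slice_decomposition a v.
by rewrite mul_slice_gap// nE//; exact: H.
Qed.

Lemma slice_bound_shrink a b s : 0 <= s <= 1 ->
  slice_bound a b -> slice_bound a (s *: b).
Proof.
move=> /andP[s0 s1] [alpha [alpha0 alphae /reducedP H]].
exists alpha; split=> //; apply/reducedP => u lambda uxi.
rewrite scalerA; apply: le_trans (H u (lambda * s) uxi) _.
rewrite ler_wpM2l// ler_wsqrtr// lerD2l ler_wpM2r//.
  by rewrite addr_ge0// mulr_ge0 ?sqr_ge0// ltW.
by rewrite exprMn ler_piMr ?sqr_ge0// expr_le1.
Qed.

Lemma slice_bound_axis a a' : slice_bound a 0 -> slice_bound a' 0.
Proof.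
move=> [alpha [alpha0 alphae /reducedP H]].
exists alpha; split=> //; apply/reducedP => u lambda uxi.
have := H u 0 uxi; rewrite expr0n/= mul0r addr0 !scaler0 !addr0.
move=> /le_trans; apply; rewrite ler_wpM2l// ler_wsqrtr// lerDl.
by rewrite mulr_ge0 ?sqr_ge0// addr_ge0// mulr_ge0 ?sqr_ge0// ltW.
Qed.

(** By Cauchy-Schwarz, [alpha * N + `|lambda| * `|b|] is at most
    [sqrt (alpha ^+ 2 + `|b| ^+ 2 / C) * sqrt (N ^+ 2 + lambda ^+ 2 * C)] for
    every [C > 0].  Here [C = 1 + kappa * a' ^+ 2] grows without bound with
    [a'], so the first factor is smaller than [eps] for [a'] large. *)
Lemma slice_bound_far a b : slice_bound a 0 ->
  exists T, forall a', T <= `|a'| -> slice_bound a' b.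
Proof.
move=> [alpha [alpha0 alphae /reducedP H]].
have eps0 : 0 < eps by exact: le_lt_trans alphae.
pose beta := `|b|.
have beta0 : 0 <= beta by exact: normr_ge0.
have gap_gt0 : 0 < eps ^+ 2 - alpha ^+ 2.
  by rewrite subr_gt0 ltr_sqr ?nnegrE// ltW.
pose T2 := (beta ^+ 2 / (eps ^+ 2 - alpha ^+ 2) + 1) / kappa.
have T2_ge0 : 0 <= T2.
  by rewrite divr_ge0 ?(ltW kappa_gt0)// addr_ge0// divr_ge0 ?sqr_ge0// ltW.
exists (Num.sqrt T2) => a' Ta'.
have a'2 : T2 <= a' ^+ 2.
  rewrite -(sqr_sqrtr T2_ge0) -[leRHS]real_normK ?num_real//.
  by rewrite ler_sqr ?nnegrE// sqrtr_ge0.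
set C := 1 + a' ^+ 2 * kappa.
have CT : beta ^+ 2 / (eps ^+ 2 - alpha ^+ 2) < C.
  have : T2 * kappa <= a' ^+ 2 * kappa by rewrite ler_wpM2r// ltW.
  by rewrite /T2 divfK ?gt_eqF// /C; lra.
have C0 : 0 < C by apply: le_lt_trans CT; rewrite divr_ge0 ?sqr_ge0// ltW.
have al : alpha ^+ 2 + beta ^+ 2 / C < eps ^+ 2.
  rewrite -ltrBrDl ltr_pdivrMr// mulrC -ltr_pdivrMr//.
have q0 : 0 <= alpha ^+ 2 + beta ^+ 2 / C.
  by rewrite addr_ge0 ?sqr_ge0// divr_ge0 ?sqr_ge0// ltW.
exists (Num.sqrt (alpha ^+ 2 + beta ^+ 2 / C)); split; first exact: sqrtr_ge0.
  by rewrite -(ger0_norm (ltW eps0)) -sqrtr_sqr ltr_sqrt// exprn_gt0.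
apply/reducedP => u lambda uxi; rewrite -/C.
set N := enorm (u *m graph_mx k Y).
have N0 : 0 <= N by exact: enorm_ge0.
have := H u 0 uxi; rewrite expr0n/= mul0r addr0 !scaler0 !addr0 -/N.
rewrite sqrtr_sqr (ger0_norm N0) => h.
have le1 : `|u *m A + lambda *: b| <= alpha * N + `|lambda| * beta.
  by rewrite (le_trans (ler_normD _ _))// normrZ lerD2r.
apply: le_trans le1 _; rewrite -sqrtrM//.
have lhs0 : 0 <= alpha * N + `|lambda| * beta.
  by rewrite addr_ge0// mulr_ge0.
rewrite -(ger0_norm lhs0) -sqrtr_sqr ler_wsqrtr//.
have lamE : lambda ^+ 2 = `|lambda| ^+ 2 by rewrite real_normK ?num_real.
rewrite lamE; set mu := `|lambda|; set D := beta / C.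
have DE : beta = D * C by rewrite /D divfK// gt_eqF.
have -> : beta ^+ 2 / C = D ^+ 2 * C.
  by rewrite DE exprMn expr2 -!mulrA mulfV ?gt_eqF// mulr1.
rewrite DE -subr_ge0.
have -> : (alpha ^+ 2 + D ^+ 2 * C) * (N ^+ 2 + mu ^+ 2 * C) -
   (alpha * N + mu * (D * C)) ^+ 2 = C * (alpha * mu - D * N) ^+ 2 by ring.
by rewrite mulr_ge0 ?sqr_ge0// ltW.
Qed.

End NormalForm.

(** * Ampleness *)

Section Ample.
Variable R : realType.

(** The kernel of the transpose of a basis matrix of [tau] is one-dimensional;
    [xi] is its unit generator, and a matrix killed by [tau] has all its columns
    in that line. *)
Lemma hyperplane_normal m (tau : {vspace 'rV[R]_m}) : (\dim tau).+1 = m ->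
  exists xi : 'cV[R]_m, [/\ xi^T *m xi = 1%:M,
    forall v, v \in tau -> v *m xi = 0 &
    forall n (D : 'M[R]_(m, n)), (forall v, v \in tau -> v *m D = 0) ->
      D = xi *m (xi^T *m D)].
Proof.
move=> dimt; set d := \dim tau.
pose B : 'M[R]_(d, m) := \matrix_(i < d) (vbasis tau)`_i.
have mulB (v : 'rV[R]_d) : v *m B = \sum_i v 0 i *: (vbasis tau)`_i.
  by rewrite mulmx_sum_row; apply: eq_bigr => i _; rewrite rowK.
have inB v : v \in tau -> exists w, v = w *m B.
  move=> vt; exists (\row_i coord (vbasis tau) i v).
  by rewrite mulB [LHS](coord_vbasis vt); apply: eq_bigr => i _; rewrite mxE.
have rB : row_free B.
  apply: inj_row_free => v; rewrite mulB => v0.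
  apply/rowP => i; rewrite mxE.
  by have /freeP/(_ (fun i => v 0 i) v0 i) := basis_free (vbasisP tau).
have rowB i : row i B \in tau.
  by rewrite rowK vbasis_mem// mem_nth// size_tuple.
have rK : \rank (kermx B^T) = 1%N.
  by rewrite mxrank_ker mxrank_tr (eqP rB) -{1}dimt -/d subSn// subnn.
pose z := nz_row (kermx B^T).
have z0 : z != 0 by rewrite nz_row_eq0 -mxrank_eq0 rK.
have zB : B *m z^T = 0.
  apply: trmx_inj; rewrite trmx_mul trmxK trmx0.
  by apply: sub_kermxP; exact: nz_row_sub.
have kz : (kermx B^T <= z)%MS.
  rewrite -(mxrank_leqif_sup (nz_row_sub _)) rK rank_rV z0//.
have ez : enorm z != 0 by apply: contra_neq z0 => /enorm_eq0.
have zz : z *m z^T = (enorm z ^+ 2)%:M by rewrite sqr_enormE.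
have xiT : ((enorm z)^-1 *: z^T)^T = (enorm z)^-1 *: z by rewrite linearZ/= trmxK.
exists ((enorm z)^-1 *: z^T); rewrite xiT; split.
- rewrite -scalemxAl -scalemxAr zz scalerA -scalemx1 scalerA.
  by rewrite -expr2 exprVn mulVf ?expf_neq0// scale1r.
- move=> v /inB[w ->]; rewrite -scalemxAr -mulmxA zB mulmx0 scaler0 //.
move=> n D HD.
have BD : B *m D = 0.
  by apply/row_matrixP => i; rewrite row_mul HD// row0.
have : (D^T <= z)%MS.
  apply: submx_trans kz; apply/sub_kermxP.
  by rewrite -trmx_mul BD trmx0.
move=> /submxP[X XE].
have -> : D = z^T *m X^T by rewrite -trmx_mul -XE trmxK.
rewrite -!scalemxAl -scalemxAr scalerA !mulmxA.
rewrite -[z^T *m z *m z^T]mulmxA zz mul_mx_scalar -scalemxAl scalerA.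
by rewrite -expr2 exprVn mulVf ?expf_neq0// scale1r.
Qed.

Lemma segment_component (V : normedModType R) (A : set V) x y :
  (forall t : R, 0 <= t <= 1 -> A (x + t *: (y - x))) ->
  connected_component A x y.
Proof.
move=> H; pose f (t : R) := x + t *: (y - x).
have imx : (f @` `[0, 1]) x.
  by exists 0; rewrite /= ?in_itv/= ?lexx ?ler01// /f scale0r addr0.
have imy : (f @` `[0, 1]) y.
  by exists 1; rewrite /= ?in_itv/= ?lexx ?ler01// /f scale1r addrC subrK.
apply: (connected_component_max imx) imy.
  by move=> _ [t t01 <-]; apply: H; move: t01; rewrite /= in_itv.
apply: connected_continuous_connected; first exact: segment_connected.
apply: continuous_subspaceT => t; apply: cvgD; first exact: cvg_cst.
by apply: cvgZr_tmp; exact: cvg_id.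
Qed.

(** Two points of [Omega] are joined by a path of three segments, through
    [Phi a 0] and [Phi a' 0].  Any point [Phi a b] is the midpoint of
    [Phi (a + s) b] and [Phi (a - s) b], which belong to [Omega] when [s] is
    large. *)
Lemma ample_of_axis (V W : normedModType R) (Phi : R -> W -> V)
    (P Omega : set V) :
  (forall a b a' b' t, Phi a b + t *: (Phi a' b' - Phi a b) =
     Phi (a + t * (a' - a)) (b + t *: (b' - b))) ->
  (forall j, P j <-> exists a b, j = Phi a b) ->
  Omega `<=` P ->
  (forall a b t, 0 <= t <= 1 -> Omega (Phi a b) -> Omega (Phi a (t *: b))) ->
  (forall a a', Omega (Phi a 0) -> Omega (Phi a' 0)) ->
  (forall a b, Omega (Phi a 0) -> exists T, forall a', T <= `|a'| -> Omega (Phi a' b)) ->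
  ample_in P Omega.
Proof.
move=> affPhi PE OP shrink axis far j0 Oj0.
have [a0 [b0 j0E]] := (PE _).1 (OP _ Oj0); subst j0.
have axis_comp a b : Omega (Phi a b) -> connected_component Omega (Phi a b) (Phi a 0).
  move=> Oab; apply: segment_component => t /andP[t0 t1].
  rewrite affPhi subrr mulr0 addr0 sub0r scalerN -[X in X - _]scale1r -scalerBl.
  by apply: shrink => //; rewrite subr_ge0 t1 gerBl.
have O0 : Omega (Phi a0 0).
  by have := @connected_component_sub _ _ _ _ (axis_comp _ _ Oj0).
have compE : connected_component Omega (Phi a0 b0) = Omega.
  apply/seteqP; split; first exact: connected_component_sub.
  move=> j Oj; have [a [b jE]] := (PE _).1 (OP _ Oj); subst j.
  apply: (connected_component_trans (axis_comp _ _ Oj0)).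
  apply: (@connected_component_trans _ _ (Phi a 0)); last first.
    by apply: connected_component_sym; exact: axis_comp.
  apply: segment_component => t _; rewrite affPhi subrr scaler0 addr0.
  exact: axis O0.
rewrite compE; apply/seteqP; split.
  apply: smallest_sub => // x y t; rewrite !inE => /PE[a [b ->]] /PE[a' [b' ->]].
  apply/PE; exists (a' + t%:num * (a - a')), (b' + t%:num *: (b - b')).
  rewrite -affPhi.
  change (t%:num *: Phi a b + (1 - t%:num) *: Phi a' b' =
    Phi a' b' + t%:num *: (Phi a b - Phi a' b')).
  by rewrite scalerBr scalerBl scale1r addrCA.
move=> j /PE[a [b ->]] C [cC OC].
have [T HT] := far _ b O0.
(* With this shift both [`|a + s|] and [`|a - s|] are at least [T]. *)
pose s := `|T| + `|a|.
have Op : Omega (Phi (a + s) b).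
  apply: HT; rewrite /s; have := ler_normB (a + (`|T| + `|a|)) a.
  rewrite [a + _ - a]addrC addKr ger0_norm ?addr_ge0// => h.
  by have := ler_norm T; lra.
have Om : Omega (Phi (a - s) b).
  apply: HT; rewrite /s; have := ler_normB (a - (`|T| + `|a|)) a.
  rewrite [a - _ - a]addrC addKr normrN ger0_norm ?addr_ge0// => h.
  by have := ler_norm T; lra.
have h0 : 0 <= (1 / 2 : R) by lra.
have h1 : (1 / 2 : R) <= 1 by lra.
have <- : (1 / 2 : R) *: Phi (a + s) b + (1 - 1 / 2 : R) *: Phi (a - s) b = Phi a b.
  have := affPhi (a - s) b (a + s) b (1 / 2).
  rewrite subrr scaler0 addr0.
  have -> : a - s + 1 / 2 * (a + s - (a - s)) = a by field.
  by move=> <-; rewrite scalerBr scalerBl scale1r addrCA.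
exact: set_mem (cC _ _ (Itv01 h0 h1) (mem_set (OC _ Op)) (mem_set (OC _ Om))).
Qed.

Variables (m k n : nat) (sigma : jet_section R (m + 1 + k) n) (eps : R).

Lemma ample_Rha : ample_relation (Rha sigma eps).
Proof.
move=> x q tau L dimt j1 Oj1.
have [xi [xi1 xitau xiD]] := hyperplane_normal dimt.
have [/RhaP[hp hy hw [al1 Hal1]] [/= x1 q1 L1]] := Oj1.
rewrite x1 q1 in hp hy hw al1 Hal1.
move: j1 Oj1 x1 q1 L1 Hal1 => [[x1 q1] th1] /= Oj1 ? ? L1; subst x1 q1 => Hal1.
set p := pt x (lsubmx q 0 0) 0 in hp hw Hal1.
set S := slin sigma p.
(* The origin of the slice: its value on [xi^T] has zero first component, and the
   second one cancels the gap there. *)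
pose th0 := th1 + xi *m (row_mx 0 (xi^T *m inx R m k *m S) - xi^T *m th1).
pose Y0 := lsubmx th0; pose W0 := rsubmx th0.
pose A := graph_gap sigma p Y0 W0.
have xith0 : xi^T *m th0 = row_mx 0 (xi^T *m inx R m k *m S).
  by rewrite /th0 [LHS]mulmxDr mulmxA xi1 mul1mx addrC subrK.
have xiY : xi^T *m Y0 = 0.
  by rewrite /Y0 mulmx_lsub xith0 row_mxKl.
have xiW : xi^T *m W0 = xi^T *m inx R m k *m S.
  by rewrite /W0 mulmx_rsub xith0 row_mxKr.
have xiA : xi^T *m A = 0.
  rewrite /A /graph_gap /graph_mx mulmxBr xiW mulmxDl mulmxDr -/S.
  by rewrite -mulmxA !mulmxA xiY !mul0mx addr0 subrr.
(* The shift of [b] by [a *: dd] turns the gap of [Phi a b] into [slice_gap]: its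
   part [iny *m S] absorbs the change of the graph with [a]. *)
pose kap := (1 + enorm Y0^T ^+ 2)^-1.
pose dd := iny R m k *m S + kap *: (Y0^T *m A).
pose Phi (a : R) (b : 'rV[R]_n) : jet R m (1 + n) :=
  (x, q, th0 + xi *m row_mx a%:M (b + a *: dd)).
have tauth0 v : v \in tau -> v *m th0 = L (vsproj tau v).
  move=> vt; rewrite /th0 [LHS]mulmxDr mulmxA xitau// mul0mx addr0.
  by rewrite -L1 vsprojK.
have PE j : principal_subspace x q L j <-> exists a b, j = Phi a b.
  split=> [|[a [b ->]]].
    move: j => [[x' q'] th] [/= -> -> Lth].
    have DE : th - th0 = xi *m (xi^T *m (th - th0)).
      by apply: xiD => v vt; rewrite mulmxBr tauth0// -Lth vsprojK// subrr.
    set r := xi^T *m _ in DE; pose a := lsubmx r 0 0.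
    exists a, (rsubmx r - a *: dd); rewrite /Phi subrK /a -mx11_scalar hsubmxK.
    by rewrite -DE addrC subrK.
  split=> //= v; rewrite mulmxDr mulmxA xitau ?mul0mx ?addr0 ?subvsP//.
  by rewrite tauth0 ?subvsP// vsvalK.
have PhiP a b : Rha sigma eps (Phi a b) <-> slice_bound k xi Y0 A eps a b.
  have linE : lsubmx (Phi a b).2 = slice_lin xi Y0 a.
    rewrite /Phi/= raddfD/= -mulmx_lsub row_mxKl /slice_lin.
    by rewrite mul_mx_scalar.
  have gapE : graph_gap sigma p (lsubmx (Phi a b).2) (rsubmx (Phi a b).2) =
      slice_gap xi Y0 A a b.
    rewrite linE /graph_gap /slice_lin /slice_gap.
    rewrite /Phi/= raddfD/= -mulmx_rsub row_mxKr -/W0.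
    have -> : graph_mx k (Y0 + a *: xi) = graph_mx k Y0 + a *: (xi *m iny R m k).
      by rewrite /graph_mx mulmxDl -scalemxAl addrA.
    have -> : xi *m (b + a *: dd) = xi *m (b + (a * kap) *: (Y0^T *m A)) +
        (a *: (xi *m iny R m k)) *m S.
      rewrite /dd scalerDr scalerA [a *: _ + _]addrC addrA [LHS]mulmxDr.
      by rewrite -scalemxAr -scalemxAl mulmxA.
    rewrite -/S [(graph_mx k Y0 + _) *m S]mulmxDl opprD addrA [W0 + _]addrA.
    by rewrite [X in X - _ = _]addrAC addrK addrAC.
  split=> [/RhaP[_ _ _ [al [al0 ale H]]]|[al [al0 ale H]]].
    by exists al; split=> // v; rewrite -gapE -linE; exact: H.
  by apply/RhaP; split=> //; exists al; split=> // v; rewrite gapE linE; exact: H.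
have OP a b : (Rha sigma eps `&` principal_subspace x q L) (Phi a b) <->
    slice_bound k xi Y0 A eps a b.
  split=> [[/PhiP]//|/PhiP H]; split=> //.
  by apply/PE; exists a, b.
apply: (@ample_of_axis _ _ Phi) Oj1 => //.
- move=> a b a' b' t; rewrite /Phi.
  set M := xi *m _; set M' := xi *m _.
  transitivity (x + t *: (x - x), q + t *: (q - q),
    (th0 + M) + t *: ((th0 + M') - (th0 + M))); first by [].
  rewrite !subrr !scaler0 !addr0; congr (_, _, _).
  rewrite opprD addrACA subrr add0r -addrA; congr (_ + _).
  rewrite /M /M' -mulmxBr scalemxAr -mulmxDr; congr (_ *m _).
  rewrite opp_row_mx add_row_mx scale_row_mx add_row_mx; congr row_mx.
    by apply/matrixP => i i'; rewrite !mxE !ord1 !mulr1n.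
  by apply/rowP => i; rewrite !mxE; ring.
- by move=> a b t t01 /OP H; apply/OP; exact: slice_bound_shrink.
- by move=> a a' /OP H; apply/OP; exact: slice_bound_axis H.
- move=> a b /OP H; have [T HT] := slice_bound_far xi1 xiY xiA b H.
  by exists T => a' /HT; rewrite -OP.
Qed.

End Ample.

(** * Compact neighborhoods and uniform bounds *)

Section CompactNeighborhoods.
Variable R : realType.

(** A locally available bound [eta < eps] becomes uniform on a compact
    neighborhood.  The parameter [e] plays two roles, radius of the neighborhood
    and margin [eps - e], so that one covering argument yields both. *)
Lemma compact_nbhd_bound d (C : set 'rV[R]_d) (Q : R -> set 'rV[R]_d) (eps : R) :
  compact C ->
  (forall eta eta' q, eta <= eta' -> Q eta q -> Q eta' q) ->
  (forall p, C p -> exists2 eta, eta < eps & \forall q \near p, Q eta q) ->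
  exists K eta, [/\ compact K, set_nbhs C K, eta < eps & K `<=` Q eta].
Proof.
move=> cC Qmono loc.
pose P e q := forall r, `|q - r| <= e -> Q (eps - e) r.
have : \forall e \near 0^'+, C `<=` P e.
  apply: (compact_near_coveringP C).1 => // p Cp.
  have [eta etae /nbhs_normP[del /= del0 Hdel]] := loc p Cp.
  near=> q e => /= r qr.
  apply: (Qmono eta); first by rewrite lerBrDl -lerBrDr; near: e; apply: nbhs_right_le; rewrite subr_gt0.
  apply: Hdel => /=; rewrite -(subrKA q) (le_lt_trans (ler_normD _ _))//.
  rewrite [ltRHS]splitr ltr_leD//; first by near: q; apply: cvgr_dist_lt => //; exact: divr_gt0.
  apply: le_trans qr _; near: e; apply: nbhs_right_le; exact: divr_gt0.
move=> nearP; near (0 : R)^'+ => e.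
have e0 : 0 < e by near: e; exact: nbhs_right_gt.
have CP : C `<=` P e by near: e.
pose Bl := [set z : 'rV[R]_d | `|0 - z| <= e].
exists ((fun pz : 'rV[R]_d * 'rV[R]_d => pz.1 + pz.2) @` (C `*` Bl)), (eps - e); split.
- apply: continuous_compact; first by apply: continuous_subspaceT; exact: add_continuous.
  apply: compact_setX => //; apply: bounded_closed_compact; last exact: closed_closed_ball_.
  exists e; split=> [|M eM z]; first exact: num_real.
  by rewrite /Bl /= sub0r normrN => /le_trans; apply; exact: ltW.
- move=> p Cp; apply: filterS (nbhsx_ballx p e e0) => q; rewrite -ball_normE /= => pq.
  exists (p, q - p); last by rewrite /= addrC subrK.
  by split => //=; rewrite /Bl/= sub0r opprB ltW.
- by rewrite gtrBl.
move=> _ [[p z] [/= Cp Bz] <-]; apply: (CP p Cp).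
by rewrite opprD addrA subrr; exact: Bz.
Unshelve. all: by end_near. Qed.

Lemma sup_over_lt (T : Type) (K : set T) (f : T -> R) (e : R) p :
  (sup_over K f < e%:E)%E -> K p -> f p < e.
Proof.
move=> supe Kp; rewrite -lte_fin; apply: le_lt_trans supe.
by apply: ereal_sup_ubound; exists p.
Qed.

Lemma sup_over_le_lt (T : Type) (K : set T) (f : T -> R) (eta e : R) :
  eta < e -> (forall p, K p -> f p <= eta) -> (sup_over K f < e%:E)%E.
Proof.
move=> etae H; apply: (@le_lt_trans _ _ eta%:E); last by rewrite lte_fin.
by apply: ge_ereal_sup => _ [p Kp <-]; rewrite lee_fin; exact: H.
Qed.

Lemma cube_compact m : compact (@cube R m).
Proof.
have := @rV_compact R m (fun=> `[0, 1]%classic) (fun=> @segment_compact _ 0 1).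
congr compact; apply/funext => x; apply/propext; split=> H i; have := H i;
  by rewrite /= in_itv.
Qed.

Lemma opnorm_open a b (M : 'M[R]_(a, b)) (e : R) : opnorm M < e ->
  exists e' d, [/\ e' < e, 0 < d & forall M', `|M - M'| < d -> opnorm M' <= e'].
Proof.
have PS M' e' := @opnorm_onP R a b setT M' e' I (fun _ _ _ => I).
move=> /PS[al [al0 ale H]].
have a1 : 0 < a%:R + 1 :> R by rewrite ltr_wpDl.
have [d d0 dE] : exists2 d, 0 < d & d * (a%:R + 1) = (e - al) / 2.
  exists ((e - al) / 2 / (a%:R + 1)); last by rewrite divfK// gt_eqF.
  by rewrite !divr_gt0// subr_gt0.
exists ((al + e) / 2), d; split=> //; first by lra.
move=> M' MM'; apply/ltW/PS; exists (al + a%:R * d); split.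
- by rewrite addr_ge0// mulr_ge0// ltW.
- by move: dE; rewrite mulrDr mulr1 mulrC; lra.
move=> u _; have -> : u *m M' = u *m M - u *m (M - M') by rewrite mulmxBr subKr.
rewrite (le_trans (ler_normB _ _))// mulrDl lerD//; first exact: H.
rewrite (le_trans (norm_mulmx_le _ _))// -!mulrA ler_wpM2l// mulrC.
by rewrite ler_pM ?norm_le_enorm// ltW.
Qed.

(** A two-sided derivative is determined by the difference quotients on one side. *)
Lemma derive_oneside (V W : normedModType R) (f : V -> W) x v (r : R) :
  0 < r -> derivable f x v -> f x = 0 ->
  (forall t, 0 < t < r -> f (t *: v + x) = 0) -> 'D_v f x = 0.
Proof.
move=> r0 dfx fx0 fv.
have /cvg_dnbhs_at_right c1 := dfx.
have c2 : h^-1 *: ((f \o shift x) (h *: v) - f x) @[h --> 0^'+] --> (0 : W).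
  apply: cvg_near_cst; near=> t; rewrite /= fx0 subr0 fv ?scaler0//.
  by apply/andP; split; near: t; [exact: nbhs_right_gt|exact: nbhs_right_lt].
exact: (cvg_unique _ c1 c2).
Unshelve. all: by end_near. Qed.

End CompactNeighborhoods.

(** * Holonomic extensions of a solution *)

Section Extension.
Variables (R : realType) (m n k : nat).

Definition projy : 'M[R]_(m + 1 + k, 1) := col_mx (col_mx 0 1%:M) 0.
Definition projz : 'M[R]_(m + 1 + k, k) := col_mx 0 1%:M.

Lemma pt_projx x y z : pt x y z *m projx R m k = x.
Proof. by rewrite /pt /projx !mul_row_col !mulmx0 !addr0 mulmx1. Qed.

Lemma pt_projy x y z : pt x y z *m projy = y%:M.
Proof. by rewrite /pt /projy !mul_row_col !mulmx0 add0r addr0 mulmx1. Qed.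

Lemma pt_projz x y z : pt x y z *m projz = z.
Proof. by rewrite /pt /projz mul_row_col mulmx0 add0r mulmx1. Qed.

Lemma ptK (u : 'rV[R]_(m + 1 + k)) :
  u = pt (u *m projx R m k) ((u *m projy) 0 0) (u *m projz).
Proof.
rewrite /projx /projy /projz -[u]hsubmxK -[lsubmx u]hsubmxK !mul_row_col.
by rewrite !mulmx0 !addr0 !add0r !mulmx1 /pt -mx11_scalar.
Qed.

Variables (sigma : jet_section R (m + 1 + k) n) (eps : R).
Variables (delta : 'rV[R]_m -> R) (h : 'rV[R]_m -> 'rV[R]_n).
Hypotheses (sdelta : smooth_on setT delta) (sh : smooth_on setT h).

Let F x : 'rV[R]_(1 + n) := row_mx (delta x)%:M (h x).
Let g x : 'rV[R]_(m + 1 + k) := pt x (delta x) 0.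

Let lF x : lsubmx (F x) = (delta x)%:M. Proof. exact: row_mxKl. Qed.
Let rF x : rsubmx (F x) = h x. Proof. exact: row_mxKr. Qed.

Let smoothF : smooth_on setT F.
Proof.
move=> r.
have := Ck_on_add openT (Ck_on_scale openT (sdelta r)
    (Ck_on_cst r setT (row_mx 1%:M 0 : 'rV[R]_(1 + n))))
  (Ck_on_linear openT (@linear_mx_continuous R _ _ _ (mulmxr (row_mx 0 1%:M : 'M[R]_(n, 1 + n))))
     (sh r)).
apply: Ck_on_eq => [|x _]; first exact: openT.
rewrite /= scale_row_mx mul_mx_row add_row_mx scaler0 mulmx0 mulmx1 addr0 add0r.
by rewrite scalemx1.
Qed.

Let dF x : differentiable F x. Proof. exact: (smoothF 1).1. Qed.

Let gE x : g x = x *m inx R m k + lsubmx (F x) *m iny R m k.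
Proof. by rewrite /g ptE mul0mx addr0 lF. Qed.

Let Ck_lin (V : normedModType R) r (U : set V) a b c d (f : V -> 'M[R]_(a, b))
    (L : {linear 'M[R]_(a, b) -> 'M[R]_(c, d)}) :
  open U -> Ck_on r U f -> Ck_on r U (fun p => L (f p)).
Proof. by move=> oU; apply: Ck_on_linear => //; exact: linear_mx_continuous. Qed.

Let Ckg r : Ck_on r setT g.
Proof.
have := Ck_on_add openT (Ck_lin (mulmxr (inx R m k)) openT (Ck_on_id r setT))
  (Ck_lin (mulmxr (iny R m k)) openT (Ck_lin lsubmx openT (smoothF r))).
by apply: Ck_on_eq => [|x _]; [exact: openT|rewrite gE].
Qed.

Let dg x : differentiable g x. Proof. exact: (Ckg 1).1. Qed.

Let Y x : 'M[R]_(m, 1) := lsubmx (jacobian F x).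
Let W x : 'M[R]_(m, n) := rsubmx (jacobian F x).

Let derive_g x v : 'D_v g x = v *m graph_mx k (Y x).
Proof.
have -> : g = (fun x => x *m inx R m k + lsubmx (F x) *m iny R m k).
  by apply/funext => y; exact: gE.
have d1 : differentiable (mulmxr (inx R m k) : 'rV_m -> 'rV_(m + 1 + k)) x.
  by apply: linear_differentiable; exact: linear_mx_continuous.
have cl : continuous (mulmxr (iny R m k) \o lsubmx : 'rV[R]_(1 + n) -> 'rV_(m + 1 + k)).
  exact: linear_mx_continuous.
have d2 : differentiable (fun x => lsubmx (F x) *m iny R m k) x.
  exact: differentiable_comp (dF x) (linear_differentiable _ cl).
rewrite (deriveD (diff_derivable d1) (diff_derivable d2)).
rewrite (derive_linear v cl (dF x)) /=.
rewrite deriveE// diff_lin /=; last exact: linear_mx_continuous.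
by rewrite deriveEjacobian// /graph_mx mulmxDr mulmxA /Y -mulmx_lsub.
Qed.

Let derive_h x v : 'D_v h x = v *m W x.
Proof.
have -> : h = (fun x => rsubmx (F x)) by apply/funext => y; rewrite rF.
have cr : continuous (rsubmx : 'rV[R]_(1 + n) -> 'rV[R]_n).
  exact: linear_mx_continuous.
by rewrite (derive_linear v cr (dF x)) deriveEjacobian// /W mulmx_rsub.
Qed.

Let RhaF x : Rha sigma eps (j1 F x) <->
  [/\ sdom sigma (g x), `|delta x| < eps, `|h x - Defs.sfun sigma (g x)| < eps &
      exists alpha, [/\ 0 <= alpha, alpha < eps & forall v,
        `|v *m graph_gap sigma (g x) (Y x) (W x)|
          <= alpha * enorm (v *m graph_mx k (Y x))]].
Proof.
have := RhaP sigma eps (j1 F x).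
by rewrite /j1 /= lF rF mxE mulr1n -/(g x) -/(Y x) -/(W x).
Qed.

Let Rha_nbhs x : Rha sigma eps (j1 F x) -> \forall y \near x, Rha sigma eps (j1 F y).
Proof.
move=> Rx.
have cJ : jacobian F @ x --> jacobian F x.
  exact: (Ck_on_jacobian openT (smoothF 1)).
have cF : F @ x --> F x by exact: (smoothF 0).
have cj : j1 F @ x --> j1 F x.
  have c1 : (fun y => (y, F y)) @ x --> (x, F x) by exact: cvg_pair cvg_id cF.
  exact: (cvg_pair c1 cJ).
by apply: cj; apply: open_nbhs_nbhs; split=> //; exact: open_Rha.
Qed.

(** The function [h - f1 \o g] vanishes on the cube, so its derivative along each
    basis vector, taken on the side that stays in the cube, is zero.  Therefore
    [W x] is the Jacobian of [f1] read on the graph, and the gap is the error of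
    [f1] restricted to the graph. *)
Lemma Rha_of_extension V f1 :
  (forall x, cube x -> f1 (pt x (delta x) 0) = h x) ->
  holonomic_solution sigma eps delta V f1 -> Rha_solution sigma eps delta h.
Proof.
move=> f1h [_ [oV cellV sf1] supd [K [cK nK KUV supf supJ]]] x cx.
apply: Rha_nbhs.
have gcell y : cube y -> cell k delta (g y) by move=> cy; exists y.
have Kg : K (g x) by exact: nbhs_singleton (nK _ (gcell _ cx)).
apply/RhaF; split; first exact: (KUV _ Kg).1.
- exact: sup_over_lt supd cx.
- by have := sup_over_lt supf Kg; rewrite /g f1h.
have /(@opnorm_onP R _ _ setT _ _ I (fun _ _ _ => I))[al [al0 ale H]] :=
  sup_over_lt supJ Kg.
exists al; split=> // v.
have df1 : differentiable f1 (g x) by apply: (sf1 1%N).1; exact/cellV/gcell.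
have df1g : differentiable (fun y => f1 (g y)) x by exact: differentiable_comp (dg x) df1.
have dh : differentiable h x by exact: (sh 1%N).1.
pose u y := h y - f1 (g y).
have du : differentiable u x by exact: differentiableB.
have u0 y : cube y -> u y = 0 by move=> cy; rewrite /u /g f1h// subrr.
have deu i : 'D_(delta_mx 0 i) u x = 0.
  (* In each coordinate, the half of the cube containing [x] decides the side. *)
  have half : 0 < 2^-1 :> R by rewrite invr_gt0.
  have [xi|xi] := leP (x 0 i) 2^-1.
    apply: (derive_oneside half); [exact: diff_derivable|exact: u0|].
    move=> t /andP[t0 t1]; apply: u0 => j; rewrite !mxE eqxx/=.
    have /andP[x0 x1] := cx j.
    have [ij|_] := eqVneq j i; last by rewrite mulr0 add0r x0.
    by rewrite ij in x0 x1 *; rewrite ?mulrN /= mulr1; apply/andP; split; lra.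
  have : 'D_(- delta_mx 0 i) u x = 0.
    apply: (derive_oneside half); [exact: diff_derivable|exact: u0|].
    move=> t /andP[t0 t1]; apply: u0 => j; rewrite !mxE eqxx/=.
    have /andP[x0 x1] := cx j.
    have [ij|_] := eqVneq j i; last by rewrite oppr0 mulr0 add0r x0.
    by rewrite ij in x0 x1 *; rewrite ?mulrN /= mulr1; apply/andP; split; lra.
  by rewrite deriveE// linearN -deriveE// => /eqP; rewrite oppr_eq0 => /eqP.
have Dv : v *m W x = v *m graph_mx k (Y x) *m jacobian f1 (g x).
  have : 'D_v u x = 0.
    by rewrite (derive_sum_coord v du) big1// => i _; rewrite deu scaler0.
  rewrite (deriveB (diff_derivable dh) (diff_derivable df1g)) derive_h.
  rewrite (derive_comp v (dg x) df1) derive_g deriveEjacobian//.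
  by move=> /eqP; rewrite subr_eq0 => /eqP.
rewrite /graph_gap mulmxBr Dv mulmxA -mulmxBr.
exact: H.
Qed.

Let S x := slin sigma (g x).
Let G x := graph_gap sigma (g x) (Y x) (W x).
Let c x := (1 + ((Y x)^T *m Y x) 0 0)^-1.
(** The derivative of the extension in the direction of the coordinate [y].  With
    [N = (- Y^T, 1, 0)] normal to the graph, it is the only choice for which the
    extension and [sigma] have the same derivative along [N]; the factor [c]
    comes from [`|N| ^+ 2 = 1 + `|Y| ^+ 2]. *)
Let normal_slope x := iny R m k *m S x + c x *: ((Y x)^T *m G x).
Let height q := q *m projy - lsubmx (F (q *m projx R m k)).

(** On the cell both [height] and the coordinate [z] vanish, so that only the
    first term remains there, and the derivative of the other two does not
    involve those of [normal_slope] and [S]. *)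
Definition extension (q : 'rV[R]_(m + 1 + k)) : 'rV[R]_n :=
  let x := q *m projx R m k in
  rsubmx (F x) + height q *m normal_slope x + (q *m projz) *m (inz R m k *m S x).

Definition extension_dom : set 'rV[R]_(m + 1 + k) :=
  [set q | sdom sigma (g (q *m projx R m k))].

Let O := [set x | sdom sigma (g x)].

Let oO : open O.
Proof.
have -> : O = g @^-1` sdom sigma by [].
by apply: open_comp => [x _|]; [exact: (Ckg 0)|exact: sdom_open].
Qed.

Let oV : open extension_dom.
Proof.
have -> : extension_dom = (mulmxr (projx R m k)) @^-1` O by [].
by apply: open_comp => [q _|]; [exact: linear_mx_continuous|exact: oO].
Qed.

Let YY x : ((Y x)^T *m Y x) 0 0 = enorm (Y x)^T ^+ 2.
Proof. by have := sqr_enormE (Y x)^T; rewrite trmxK => <-; rewrite mxE mulr1n. Qed.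

Let c_neq0 x : 1 + ((Y x)^T *m Y x) 0 0 != 0.
Proof. by rewrite YY gt_eqF// ltr_pwDl// sqr_ge0. Qed.

Let CkS r : Ck_on r O S.
Proof.
have gO x : O x -> sdom sigma (g x) by [].
have CkgO : Ck_on r O g by exact: Ck_on_sub (Ckg r).
exact: (Ck_on_comp oO gO (slin_smooth sigma r) CkgO).
Qed.

Let Ck_normal_slope r : Ck_on r O normal_slope.
Proof.
have CkF r' : Ck_on r' O F by exact: Ck_on_sub (smoothF r').
have CkJ := Ck_on_jacobian oO (CkF r.+1).
have CkY : Ck_on r O Y by exact: (Ck_lin lsubmx oO CkJ).
have CkYT : Ck_on r O (fun x => (Y x)^T) by exact: (Ck_lin trmx oO CkY).
have CkW : Ck_on r O W by exact: (Ck_lin rsubmx oO CkJ).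
have CkG : Ck_on r O G.
  apply: Ck_on_add oO CkW (Ck_on_opp oO (Ck_on_mulmx oO _ (CkS r))).
  by apply: Ck_on_add oO (Ck_on_cst r O (inx R m k)) (Ck_lin (mulmxr (iny R m k)) oO CkY).
have Ckc : Ck_on r O c.
  apply: Ck_on_inv => //; apply: Ck_on_add oO (Ck_on_cst r O (1 : R)) _.
  apply: (Ck_on_linear (L := mxcoord 0 0)) oO _ (Ck_on_mulmx oO CkYT CkY).
  exact: linear_mx_continuous.
exact: Ck_on_add oO (Ck_on_mulmx oO (Ck_on_cst r O _) (CkS r))
  (Ck_on_scale oO Ckc (Ck_on_mulmx oO CkYT CkG)).
Qed.

Let Ck_pull (Z : normedModType R) r (f : 'rV[R]_m -> Z) :
  Ck_on r O f -> Ck_on r extension_dom (fun q => f (q *m projx R m k)).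
Proof.
move=> cf; apply: (Ck_on_comp oV _ cf (Ck_lin (mulmxr (projx R m k)) oV (Ck_on_id r _))).
by [].
Qed.

Let CkF_pull r : Ck_on r extension_dom (fun q => F (q *m projx R m k)).
Proof. by apply: Ck_pull; exact: Ck_on_sub (smoothF r). Qed.

Let Ck_height r : Ck_on r extension_dom height.
Proof.
exact: Ck_on_add oV (Ck_lin (mulmxr projy) oV (Ck_on_id r _))
  (Ck_on_opp oV (Ck_lin lsubmx oV (CkF_pull r))).
Qed.

Lemma smooth_extension : smooth_on extension_dom extension.
Proof.
move=> r; apply: Ck_on_add oV (Ck_on_add oV _ _) _.
- exact: (Ck_lin rsubmx oV (CkF_pull r)).
- by apply: Ck_on_mulmx oV (Ck_height r) (Ck_pull (Ck_normal_slope r)).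
- apply: Ck_on_mulmx oV (Ck_lin (mulmxr projz) oV (Ck_on_id r _)) _.
  exact: Ck_on_mulmx oV (Ck_on_cst r _ _) (Ck_pull (CkS r)).
Qed.

Lemma extension_pt x : extension (g x) = h x.
Proof.
rewrite /extension /height /g pt_projx pt_projy pt_projz lF rF subrr.
by rewrite !mul0mx !addr0.
Qed.

Let derive_mulr a b c' (M : 'M[R]_(b, c')) (p u : 'M[R]_(a, b)) :
  'D_u (fun q => q *m M) p = u *m M.
Proof.
have cM : continuous (mulmxr M : 'M[R]_(a, b) -> 'M[R]_(a, c')).
  exact: linear_mx_continuous.
by rewrite (deriveE _ (linear_differentiable p cM)) diff_lin.
Qed.

Let diff_mulr a b c' (M : 'M[R]_(b, c')) (p : 'M[R]_(a, b)) :
  differentiable (fun q => q *m M) p.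
Proof.
by apply: (linear_differentiable (f := mulmxr M)); exact: linear_mx_continuous.
Qed.

Let gK x : g x *m projx R m k = x. Proof. exact: pt_projx. Qed.

Let dF_pull q : differentiable (fun q => F (q *m projx R m k)) q.
Proof. exact: differentiable_comp (diff_mulr _ _) (dF _). Qed.

Let derive_F_pull q u : 'D_u (fun q => F (q *m projx R m k)) q =
  u *m projx R m k *m jacobian F (q *m projx R m k).
Proof.
rewrite (derive_comp u (diff_mulr _ q) (dF _)) derive_mulr.
exact: deriveEjacobian.
Qed.

Let lsub_cont : continuous (lsubmx : 'rV[R]_(1 + n) -> 'rV_1).
Proof. exact: linear_mx_continuous. Qed.

Let rsub_cont : continuous (rsubmx : 'rV[R]_(1 + n) -> 'rV_n).
Proof. exact: linear_mx_continuous. Qed.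

Let dl_pull q : differentiable (fun q => lsubmx (F (q *m projx R m k))) q.
Proof. exact: differentiable_comp (dF_pull q) (linear_differentiable _ lsub_cont). Qed.

Let dr_pull q : differentiable (fun q => rsubmx (F (q *m projx R m k))) q.
Proof. exact: differentiable_comp (dF_pull q) (linear_differentiable _ rsub_cont). Qed.

Let dheight q : differentiable height q.
Proof. exact: differentiableB (diff_mulr _ _) (dl_pull q). Qed.

Let derive_height q u : 'D_u height q =
  u *m (projy - projx R m k *m Y (q *m projx R m k)).
Proof.
rewrite /height (deriveB (diff_derivable (diff_mulr _ q)) (diff_derivable (dl_pull q))).
rewrite derive_mulr (derive_linear u lsub_cont (dF_pull q)) derive_F_pull.
by rewrite mulmxBr /Y mulmxA mulmx_lsub.
Qed.

Let derive_extension x u : O x -> 'D_u extension (g x) =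
  u *m (projx R m k *m W x + (projy - projx R m k *m Y x) *m normal_slope x +
        projz *m inz R m k *m S x).
Proof.
move=> Ox.
have Vg : extension_dom (g x) by rewrite /extension_dom /= gK.
have dN : differentiable (fun q => normal_slope (q *m projx R m k)) (g x).
  exact: (Ck_pull (Ck_normal_slope 1)).1.
have dS : differentiable (fun q => inz R m k *m S (q *m projx R m k)) (g x).
  exact: (Ck_on_mulmx oV (Ck_on_cst 1 _ _) (Ck_pull (CkS 1))).1.
have d2 : differentiable (fun q => height q *m normal_slope (q *m projx R m k)) (g x).
  exact: (differentiable_mulmx (dheight (g x)) dN).
have d3 : differentiable (fun q : 'rV_(m + 1 + k) =>
    q *m projz *m (inz R m k *m S (q *m projx R m k))) (g x).
  exact: (differentiable_mulmx (diff_mulr projz (g x)) dS).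
have d12 := differentiableD (dr_pull (g x)) d2.
rewrite (deriveD (diff_derivable d12) (diff_derivable d3)).
rewrite (deriveD (diff_derivable (dr_pull (g x))) (diff_derivable d2)).
rewrite (derive_linear u rsub_cont (dF_pull _)) derive_F_pull.
rewrite (derive_mulmx u (dheight (g x)) dN).
rewrite (derive_mulmx u (diff_mulr projz (g x)) dS).
rewrite derive_height derive_mulr gK /height gK pt_projy pt_projz lF subrr.
rewrite !mul0mx !add0r [RHS]mulmxDr [X in _ = X + _]mulmxDr !mulmxA /=.
by rewrite -mulmx_rsub.
Qed.

(** The error in a direction [u] is the gap [G x] at the parameter of the
    orthogonal projection of [u] onto the graph: the matrix in front of [G x]
    computes this parameter. *)
Let jacobian_extension x : O x -> jacobian extension (g x) - S x =
  (projx R m k + (projy - projx R m k *m Y x) *m (c x *: (Y x)^T)) *m G x.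
Proof.
move=> Ox.
have Vg : extension_dom (g x) by rewrite /extension_dom /= gK.
have dext : differentiable extension (g x) by exact: (smooth_extension 1).1.
have -> : jacobian extension (g x) = projx R m k *m W x +
    (projy - projx R m k *m Y x) *m normal_slope x + projz *m inz R m k *m S x.
  apply/row_matrixP => i.
  by rewrite !rowE -deriveEjacobian// derive_extension.
have idE : (1%:M : 'M[R]_(m + 1 + k)) =
    projx R m k *m inx R m k + projy *m iny R m k + projz *m inz R m k.
  apply/row_matrixP => i; rewrite !rowE mulmx1.
  set u := delta_mx 0 i; rewrite [LHS]ptK ptE -mx11_scalar.
  by rewrite !mulmxDr !mulmxA.
have WE : W x = G x + (inx R m k + Y x *m iny R m k) *m S x by rewrite /G subrK.
have NE : normal_slope x = iny R m k *m S x + (c x *: (Y x)^T) *m G x.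
  by rewrite /normal_slope -scalemxAl.
rewrite WE NE; move: (G x) (S x) (Y x) (c x *: (Y x)^T) => G' S' Y' C'.
move: idE; set Px := projx R m k; set D := projy - _ => idE.
have {}idE : (1%:M : 'M[R]_(m + 1 + k)) =
    Px *m (inx R m k + Y' *m iny R m k) + D *m iny R m k + projz *m inz R m k.
  rewrite idE /D mulmxDr mulmxBl !mulmxA; congr (_ + _).
  by rewrite -addrA [_ + (_ - _)]addrC subrK.
rewrite -[X in _ - X]mul1mx idE; move: (inx R m k + _) => I'.
clearbody D; rewrite !mulmxDl !mulmxDr !mulmxA.
have cancel (V : zmodType) (a b d e z : V) : a + b + (d + e) + z - (b + d + z) = a + e.
  by rewrite [a + b]addrC addrACA [_ + z]addrAC [X in X - _]addrC addrK.
exact: cancel.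
Qed.

(** Orthogonal projection onto the graph does not increase the norm. *)
Let graph_projection_le x u :
  enorm (u *m (projx R m k + (projy - projx R m k *m Y x) *m (c x *: (Y x)^T))
           *m graph_mx k (Y x)) <= enorm u.
Proof.
rewrite -ler_sqr ?nnegrE ?enorm_ge0// mul_graph_mx sqr_enorm_pt enorm0 expr0n/= addr0.
rewrite [u in leRHS]ptK sqr_enorm_pt.
set v := u *m projx R m k; set w := (u *m projy) 0 0.
set t := w - (v *m Y x) 0 0; set l := enorm (Y x)^T ^+ 2.
have l0 : 0 <= l by exact: sqr_ge0.
have cE : c x * (1 + l) = 1 by rewrite /c YY mulVf// -YY c_neq0.
have -> : u *m (projx R m k + (projy - projx R m k *m Y x) *m (c x *: (Y x)^T)) =
    v + (t * c x) *: (Y x)^T.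
  rewrite mulmxDr mulmxA -/v mulmxBr mulmxA -/v.
  rewrite [u *m projy - _]mx11_scalar mul_scalar_mx scalerA; congr (_ + (_ * _) *: _).
  by rewrite mxE [X in _ + X]mxE.
have yE : ((v + (t * c x) *: (Y x)^T) *m Y x) 0 0 = (v *m Y x) 0 0 + t * c x * l.
  by rewrite mulmxDl -scalemxAl mxE [X in _ + X]mxE YY.
rewrite yE.
have -> : enorm (v + (t * c x) *: (Y x)^T) ^+ 2 =
    enorm v ^+ 2 + (t * c x * (v *m Y x) 0 0) *+ 2 + (t * c x) ^+ 2 * l.
  rewrite sqr_enormD enormZ exprMn real_normK ?num_real// -/l.
  by rewrite linearZ/= trmxK -scalemxAr mxE.
have -> : w = (v *m Y x) 0 0 + t by rewrite /t addrC subrK.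
have key (s t' c' N z : R) : 0 <= z -> c' * (1 + l) = 1 ->
    N + (t' * c' * s) *+ 2 + (t' * c') ^+ 2 * l + (s + t' * c' * l) ^+ 2 <=
    N + (s + t') ^+ 2 + z.
  move=> z0 c'E.
  have c0 : 0 <= c' by rewrite -(@pmulr_lge0 _ (1 + l)) ?c'E// ltr_pwDl.
  rewrite -subr_ge0.
  have -> : N + (s + t') ^+ 2 + z -
    (N + (t' * c' * s) *+ 2 + (t' * c') ^+ 2 * l + (s + t' * c' * l) ^+ 2) =
    z + t' ^+ 2 * (1 - c' * l * (c' * (1 + l))) +
    2 * s * t' * (1 - c' * (1 + l)) by ring.
  rewrite c'E subrr mulr0 addr0 addr_ge0// mulr_ge0 ?sqr_ge0//.
  by rewrite mulr1; move: c'E; rewrite mulrDr mulr1; lra.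
by apply: key => //; exact: sqr_ge0.
Qed.

Lemma extension_of_Rha : Rha_solution sigma eps delta h ->
  holonomic_solution sigma eps delta extension_dom extension.
Proof.
move=> sol.
have Rc x : cube x -> Rha sigma eps (j1 F x).
  by move=> cx; exact: nbhs_singleton (sol x cx).
have Oc x : cube x -> O x by move=> /Rc /RhaF[].
have Vc : cell k delta `<=` extension_dom.
  by move=> _ [x cx <-]; rewrite /extension_dom /= pt_projx; exact: Oc.
have ccell : compact (cell k delta).
  apply: (continuous_compact (f := g)); last exact: cube_compact.
  by apply: continuous_subspaceT => x; exact: (Ckg 0).
split=> //.
- by split=> //; exact: smooth_extension.
- have mono eta eta' (x : 'rV[R]_m) : eta <= eta' -> `|delta x| <= eta -> `|delta x| <= eta'.
    by move=> le1 /le_trans; exact.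
  have loc x : cube x -> exists2 eta, eta < eps & \forall y \near x, `|delta y| <= eta.
    move=> /Rc/RhaF[_ dx _ _]; exists ((`|delta x| + eps) / 2); first by lra.
    have lt1 : `|delta x| < (`|delta x| + eps) / 2 by lra.
    have cd : delta @ x --> delta x by exact: (sdelta 0).
    have : \forall y \near x, `|delta y| < (`|delta x| + eps) / 2.
      by move/cvg_norm : cd => /(_ _ (lt_nbhsl lt1)).
    by apply: filterS => y /= /ltW.
  have [K [eta [_ nK etae KQ]]] := compact_nbhd_bound (@cube_compact R m) mono loc.
  apply: sup_over_le_lt etae _ => x cx.
  by apply: KQ; exact: nbhs_singleton (nK x cx).
pose Q eta (q : 'rV[R]_(m + 1 + k)) := [/\ (sdom sigma `&` extension_dom) q,
  `|extension q - Defs.sfun sigma q| <= eta &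
  opnorm (jacobian extension q - slin sigma q) <= eta].
have mono eta eta' q : eta <= eta' -> Q eta q -> Q eta' q.
  by move=> le1 [h1 h2 h3]; split=> //; exact: le_trans le1.
have loc p : cell k delta p -> exists2 eta, eta < eps & \forall q \near p, Q eta q.
  move=> [x cx <-]; rewrite -/(g x).
  have [sx _ hx [al [al0 ale H]]] := (RhaF x).1 (Rc x cx).
  have : opnorm (jacobian extension (g x) - slin sigma (g x)) < eps.
    apply/(@opnorm_onP R _ _ setT _ _ I (fun _ _ _ => I)).
    exists al; split=> // u _; rewrite -/(S x) jacobian_extension; last exact: sx.
    rewrite mulmxA; apply: le_trans (H _) _.
    by rewrite ler_wpM2l//; exact: graph_projection_le.
  move=> /opnorm_open[e' [d [e'e d0 Hd]]].
  have Vg : extension_dom (g x) by rewrite /extension_dom /= gK.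
  pose e2 := (`|h x - Defs.sfun sigma (g x)| + eps) / 2.
  have lt2 : `|h x - Defs.sfun sigma (g x)| < e2 by rewrite /e2; lra.
  have e2e : e2 < eps by rewrite /e2; lra.
  have ce : extension @ g x --> extension (g x) by exact: (smooth_extension 0).
  have cJ : jacobian extension @ g x --> jacobian extension (g x).
    exact: (Ck_on_jacobian oV (smooth_extension 1)).
  have cf : Defs.sfun sigma @ g x --> Defs.sfun sigma (g x).
    exact: (sfun_smooth sigma 0).
  have cS : slin sigma @ g x --> slin sigma (g x) by exact: (slin_smooth sigma 0).
  have cJS : (fun q => jacobian extension q - slin sigma q) @ g x -->
      jacobian extension (g x) - slin sigma (g x) by exact: (cvgB cJ cS).
  have cef : (fun q => extension q - Defs.sfun sigma q) @ g x -->
      h x - Defs.sfun sigma (g x) by rewrite -extension_pt; exact: (cvgB ce cf).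
  have n1 : \forall q \near g x, (sdom sigma `&` extension_dom) q.
    by apply: open_nbhs_nbhs; split; [apply: openI; [exact: sdom_open|exact: oV]|split; [exact: sx|exact: Vg]].
  have n2 : \forall q \near g x, `|extension q - Defs.sfun sigma q| < e2.
    by move/cvg_norm : cef => /(_ _ (lt_nbhsl lt2)).
  have n3 : \forall q \near g x, `|jacobian extension (g x) - slin sigma (g x) -
      (jacobian extension q - slin sigma q)| < d.
    by move/cvgrPdist_lt : cJS; exact.
  exists (Num.max e' e2); first by rewrite gt_max e'e e2e.
  near=> q; split.
  - by near: q.
  - by rewrite le_max; apply/orP; right; apply/ltW; near: q.
  - by rewrite le_max; apply/orP; left; apply: Hd; near: q.
have [K [eta [cK nK etae KQ]]] := compact_nbhd_bound ccell mono loc.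
exists K; split=> //.
- by move=> q /KQ[].
- by apply: sup_over_le_lt etae _ => q /KQ[].
- by apply: sup_over_le_lt etae _ => q /KQ[].
Unshelve. all: by end_near. Qed.

End Extension.

(** * The theorem *)

Theorem mainTheorem1 (R : realType) (m n k : nat)
    (sigma : jet_section R (m + 1 + k) n) (eps : R)
    (sigmaA : cell k (fun _ : 'rV[R]_m => 0) `<=` sdom sigma)
    (eps_gt0 : 0 < eps) :
  (forall (delta : 'rV[R]_m -> R) (h : 'rV[R]_m -> 'rV[R]_n),
     smooth_on setT delta -> smooth_on setT h ->
     ((exists (V : set 'rV[R]_(m + 1 + k)) (f1 : 'rV[R]_(m + 1 + k) -> 'rV[R]_n),
         (forall x, cube x -> f1 (pt x (delta x) 0) = h x) /\
         holonomic_solution sigma eps delta V f1)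
      <-> Rha_solution sigma eps delta h)) /\
  (open (Rha sigma eps) /\ ample_relation (Rha sigma eps)).
Proof.
split; last by split; [exact: open_Rha|exact: ample_Rha].
move=> delta h sdelta sh; split=> [[V [f1 [f1h sol]]]|sol].
  exact: Rha_of_extension f1h sol.
exists (extension_dom sigma delta), (extension sigma delta h); split.
  by move=> x _; exact: extension_pt.
exact: extension_of_Rha.
Qed.
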